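(* Let $k\ge 2$ be an integer, let $\alpha\ge 1$, and let $A$ be an offline $\alpha$-approximation algorithm for $k$-means. Let $X=\{x_1,\dots,x_n\}\subset\mathbb{R}^D$ be a set of $n$ distinct points, presented to Algorithm 1 (described in the context) in an arbitrary order. Let $S\subseteq X$ be the set of centers returned by Algorithm 1 run with inputs $X$, $k$, $A$. Then: (1) with probability at least $0.9$, $\mathcal{L}(X,S)\le 1358\,\alpha k^3\,\mathcal{L}_k(X)$; (2) $\mathbb{E}[|S|]\le 160\,\mathrm{OC}_k(X)\,k\log(k)\,(\log n+1)$.
   Context: Distances are Euclidean: $d(x,y)=\|x-y\|_2$. For a finite set $S$ and a finite nonempty set of centers $C$, $\mathcal{L}(S,C)=\sum_{x\in S}\min_{c\in C}d(x,c)^2$; $\mathcal{L}(S)=\sum_{x\in S}d(x,\mu_S)^2$ where $\mu_S$ is the mean of $S$; $\mathcal{L}_k(S)$ is the minimum of $\sum_j \mathcal{L}(P_j)$ over all partitions of $S$ into at most $k$ parts (optimal $k$-means cost). An offline $\alpha$-approximation algorithm $A$ takes a finite point set $S$ and $k$ and outputs a partition of $S$ into at most $k$ nonempty clusters with centers, whose cost $\sum_j\sum_{x\in C^j}d(x,c^j)^2$ is at most $\alpha\mathcal{L}_k(S)$. Algorithm 1 (online, no-substitution): set $C=\emptyset$. For $t=1,\dots,n$ (upon arrival of $x_t$): run $A$ on $\{x_1,\dots,x_t\}$, obtaining nonempty clusters $C_t^1,\dots,C_t^{k_t}$ ($k_t\le k$); let $c_t^j$ be the mean of $C_t^j$; index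 the clusters so that $d(c_t^1,x_t)\le\dots\le d(c_t^{k_t},x_t)$ (ties arbitrary); let $L_t=\sum_j\mathcal{L}(C_t^j)$; let $v_t=\max\{i: \sum_{j=1}^i|C_t^j|\,d(c_t^j,c_t^i)^2\le 100L_t\}$; let $s_t=\sum_{j=1}^{v_t}|C_t^j|$; then, independently of everything else, add $x_t$ to $C$ with probability $\min(1,\,20k\ln k/s_t)$. The decision about $x_t$ is made before $x_{t+1}$ arrives and is irrevocable. Output $C$. For $\beta>1$ and integer $k\ge 1$, $\mathrm{diam}(P)=\max_{x,y\in P}d(x,y)$ (0 for a singleton or empty set), and $\mathrm{diam}_\ell(P)$ is the minimum over partitions of $P$ into at most $\ell$ parts of the largest part diameter. A $(\beta,k)$-sequence is a sequence of points $y_1,\dots,y_m$ such that for every $1<j\le m$, $\min_{1\le i\le j-1}d(y_i,y_j)>\beta\,\mathrm{diam}_{k-1}(\{y_1,\dots,y_{j-1}\})$. $\mathrm{OC}_k(X)$ is the maximum length of a $(2,k)$-sequence of distinct points of $X$. In the bound, $\log k$ is the natural logarithm and $\log n$ is the base-2 logarithm. Probabilities/expectations are over the randomness of the algorithm. *)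

(* Defs.v *)
From mathcomp Require Import all_boot all_order all_algebra.
From mathcomp Require Import finmap.
From mathcomp Require Import all_classical all_reals all_analysis.

Set Implicit Arguments.
Unset Strict Implicit.
Unset Printing Implicit Defensive.

Import Order.TTheory GRing.Theory Num.Theory.

Local Open Scope classical_set_scope.
Local Open Scope ring_scope.

(* The norm that MathComp-Analysis puts on 'rV[R]_D is the sup norm, hence an
   explicit Euclidean distance. *)
Definition eucl_dist (R : realType) (D : nat) (x y : 'rV[R]_D) : R :=
  Num.sqrt (\sum_(i < D) (x ord0 i - y ord0 i) ^+ 2).

(* Minima over finite nonempty sets of reals are written with [inf]; recall
   that [inf set0 = 0], so that [cost S fset0 = 0]: statements about [cost S C]
   are only meaningful together with [C != fset0]. *)
Definition cost (R : realType) (D : nat) (S C : {fset 'rV[R]_D}) : R :=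
  \sum_(x <- S) inf [set eucl_dist x c ^+ 2 | c in [set` C]].

Definition fmean (R : realType) (D : nat) (S : {fset 'rV[R]_D}) : 'rV[R]_D :=
  #|` S|%:R^-1 *: \sum_(x <- S) x.

Definition mean_cost (R : realType) (D : nat) (S : {fset 'rV[R]_D}) : R :=
  \sum_(x <- S) eucl_dist x (fmean S) ^+ 2.

Definition fpartition (K : choiceType) (S : {fset K}) (P : {fset {fset K}}) :=
  [/\ fcover P = S, trivIfset P & fset0 \notin P].

Definition fpartitions_le (K : choiceType) (S : {fset K}) (k : nat)
    : set {fset {fset K}} :=
  [set P | fpartition S P /\ (#|` P| <= k)%N].

Definition opt_cost (R : realType) (D : nat) (k : nat) (S : {fset 'rV[R]_D})
    : R :=
  inf [set \sum_(B <- P) mean_cost B | P in fpartitions_le S k].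

(* An offline algorithm maps a finite set of points and a number k to a set of
   clusters, together with a center for each cluster. *)
Definition offline_algorithm (R : realType) (D : nat) :=
  {fset 'rV[R]_D} -> nat ->
    {fset {fset 'rV[R]_D}} * ({fset 'rV[R]_D} -> 'rV[R]_D).

Definition approx_algorithm (R : realType) (D : nat) (alpha : R)
    (A : offline_algorithm R D) : Prop :=
  forall (S : {fset 'rV[R]_D}) (k : nat), (0 < k)%N ->
    fpartitions_le S k (A S k).1 /\
    \sum_(B <- (A S k).1) \sum_(x <- B) eucl_dist x ((A S k).2 B) ^+ 2
      <= alpha * opt_cost k S.

(* [Cs] lists the clusters of [P] by nondecreasing distance of their means to
   [y]; ties may be broken in any way. *)
Definition sorted_clusters (R : realType) (D : nat)
    (P : {fset {fset 'rV[R]_D}}) (y : 'rV[R]_D) (Cs : seq {fset 'rV[R]_D}) :=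
  perm_eq Cs P /\
  sorted (fun B B' => eucl_dist (fmean B) y <= eucl_dist (fmean B') y) Cs.

Definition clusters_cost (R : realType) (D : nat) (Cs : seq {fset 'rV[R]_D})
    : R :=
  \sum_(B <- Cs) mean_cost B.

(* The largest v such that the v-th cluster of [Cs] passes the test, counted
   from 1 (whereas [i] and [j] are 0-based); the first cluster always passes. *)
Definition near_clusters (R : realType) (D : nat) (Cs : seq {fset 'rV[R]_D})
    : nat :=
  (\max_(i < size Cs |
      (\sum_(j < i.+1) #|` nth fset0 Cs j|%:R *
         eucl_dist (fmean (nth fset0 Cs j)) (fmean (nth fset0 Cs i)) ^+ 2
       <= 100 * clusters_cost Cs)%R) i.+1)%N.

Definition near_mass (R : realType) (D : nat) (Cs : seq {fset 'rV[R]_D})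
    : nat :=
  (\sum_(j < near_clusters Cs) #|` nth fset0 Cs j|)%N.

Definition accept_prob (R : realType) (D : nat) (k : nat)
    (Cs : seq {fset 'rV[R]_D}) : R :=
  Num.min 1 (20 * k%:R * ln k%:R / (near_mass Cs)%:R).

Definition mutually_independent d (T : measurableType d) (R : realType)
    (P : probability T R) (I : finType) (E : I -> set T) : Prop :=
  forall J : {set I},
    P (\bigcap_(i in [set` J]) E i) = (\prod_(i in J) P (E i))%E.

(* [S : T -> {fset _}] is the random output of the online no-substitution
   algorithm on the stream [x 0, ..., x (n - 1)]: [Cs t] is the sorted
   clustering of the first t + 1 points and [acc t] the event that [x t] is
   added. The clusterings are deterministic, so "independently of everything
   else" amounts to the mutual independence of the events [acc t]. *)
Definition online_kmeans (R : realType) (D : nat) (A : offline_algorithm R D)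
    (k n : nat) (x : 'I_n -> 'rV[R]_D) d (T : measurableType d)
    (P : probability T R) (S : T -> {fset 'rV[R]_D}) : Prop :=
  exists (Cs : 'I_n -> seq {fset 'rV[R]_D}) (acc : 'I_n -> set T),
    [/\ forall t : 'I_n, sorted_clusters
          (A [fset x i | i in 'I_n & (i <= t)%N]%fset k).1 (x t) (Cs t),
        forall t, measurable (acc t),
        forall t, P (acc t) = (accept_prob k (Cs t))%:E,
        mutually_independent P acc &
        forall w, S w = [fset x t | t in 'I_n & w \in acc t]%fset].

Definition diam (R : realType) (D : nat) (S : {fset 'rV[R]_D}) : R :=
  \big[Num.max/0]_(x <- S) \big[Num.max/0]_(y <- S) eucl_dist x y.

Definition diam_le (R : realType) (D : nat) (l : nat) (S : {fset 'rV[R]_D})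
    : R :=
  inf [set \big[Num.max/0]_(B <- P) diam B | P in fpartitions_le S l].

(* 0-based: the j-th entry is compared with the first j entries [take j s]. *)
Definition beta_k_sequence (R : realType) (D : nat) (beta : R) (k : nat)
    (s : seq 'rV[R]_D) : Prop :=
  forall j : nat, (0 < j < size s)%N ->
    inf [set eucl_dist y s`_j | y in [set` take j s]]
      > beta * diam_le k.-1 [fset y in take j s]%fset.

Definition OC (R : realType) (D : nat) (k : nat) (X : {fset 'rV[R]_D}) : nat :=
  (\max_(m < #|` X|.+1 |
      `[< exists s : seq 'rV[R]_D,
            [/\ size s = m, uniq s, {subset s <= X}
              & beta_k_sequence 2 k s] >]) m)%N.

(* Main.v *)
Require Import Defs.
From mathcomp Require Import all_boot all_order all_algebra finmap.
From mathcomp Require Import all_classical all_reals all_analysis.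
From mathcomp Require Import measurable_realfun ring lra zify.

Set Implicit Arguments.
Unset Strict Implicit.
Unset Printing Implicit Defensive.

Import Order.TTheory GRing.Theory Num.Theory.

Local Open Scope classical_set_scope.
Local Open Scope ring_scope.

(** Part 1.  Let [w = alpha * opt_cost k X], let [B] be an optimal block with [N]
    points and mean [b], and put [u = sqrt (w / N)].  At least [3 N / 4] points of
    [B] are within [2 u] of [b], and at least [N / 2] of these arrive when at
    least [N / 4] of them are present.  If [near_mass] is at most [2 k N] at all
    of these times, then one of them is selected except with probability at
    most [exp (- 5 ln k) = k ^ -5], so that all such blocks are hit except with
    probability [k ^ -4 <= 1 / 16].  Otherwise, at one of these times, more than
    [2 k N] points belong to clusters whose centers are within [26 u] of the new
    point; by the pigeonhole principle, more than [2 N] of them lie in a single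
    optimal block [B'], whose mean is then within [30 u] of [b].  Following such
    blocks, which are larger and larger, ends at a hit block.

    Part 2.  If [near_mass <= M] at time [t], then all but fewer than [2 M] of
    the points seen so far lie in [k - 1] sets of diameter at most
    [2 sqrt (L_t / M)] and at distance more than [4 sqrt (L_t / M)] from [x t].
    Coloring greedily with [2 M] colors so that no time is in conflict with an
    earlier time of its own color makes every color class a (2, k)-sequence;
    hence there are at most [2 M OC] such times [t].  Summing [1 / near_mass]
    over dyadic ranges gives at most [4 OC (log n + 1)]. *)

(** * Euclidean geometry and sums of squares around the mean *)

Section EuclideanDistance.
Variables (R : realType) (D : nat).
Implicit Types (x y z c : 'rV[R]_D) (S : {fset 'rV[R]_D}).
Local Notation dist := (@eucl_dist R D).

(** Cauchy-Schwarz: the quadratic [t ^+ 2 * a - 2 * t * b + c] is a sum of squares, and its value at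
    [t = b / a] gives the inequality. If [a = 0], all [f i] vanish. *)
Lemma sum_mul_sqr_le (I : finType) (f g : I -> R) :
  (\sum_i f i * g i) ^+ 2 <= (\sum_i f i ^+ 2) * (\sum_i g i ^+ 2).
Proof.
set a := \sum_i f i ^+ 2; set b := \sum_i f i * g i; set c := \sum_i g i ^+ 2.
have a0 : 0 <= a by apply: sumr_ge0 => i _; exact: sqr_ge0.
have quad t : 0 <= t ^+ 2 * a - 2 * t * b + c.
  rewrite [leRHS](_ : _ = \sum_i (t * f i - g i) ^+ 2); last first.
    rewrite /a /b /c !mulr_sumr -sumrB -big_split /=.
    by apply: eq_bigr => i _; ring.
  by apply: sumr_ge0 => i _; exact: sqr_ge0.
move: a0; rewrite le_eqVlt => /orP[/eqP a0|a0].
  have b0 : b = 0.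
    apply: big1 => i _; suff -> : f i = 0 by rewrite mul0r.
    apply/eqP; rewrite -sqrf_eq0; apply/eqP.
    have /psumr_eq0P -> // : \sum_i f i ^+ 2 = 0 by [].
    by move=> j _; exact: sqr_ge0.
  by rewrite b0 expr0n mulr_ge0 // -?a0 //; apply: sumr_ge0 => i _; exact: sqr_ge0.
have := quad (b / a); rewrite -(ler_pM2l a0) mulr0.
suff -> : a * ((b / a) ^+ 2 * a - 2 * (b / a) * b + c) = a * c - b ^+ 2 by lra.
by field; rewrite gt_eqF.
Qed.

Lemma eucl_dist_sqr x y :
  dist x y ^+ 2 = \sum_(i < D) (x ord0 i - y ord0 i) ^+ 2.
Proof. by rewrite sqr_sqrtr //; apply: sumr_ge0 => i _; exact: sqr_ge0. Qed.

Lemma eucl_dist_ge0 x y : 0 <= dist x y.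
Proof. exact: sqrtr_ge0. Qed.

Lemma eucl_distC x y : dist x y = dist y x.
Proof. by rewrite /eucl_dist; congr Num.sqrt; apply: eq_bigr => i _; ring. Qed.

Lemma eucl_distxx x : dist x x = 0.
Proof.
rewrite /eucl_dist big1 ?sqrtr0 // => i _.
by rewrite subrr expr0n.
Qed.

Lemma eucl_dist_triangle y x z : dist x z <= dist x y + dist y z.
Proof.
rewrite -ler_sqr ?nnegrE ?addr_ge0 ?eucl_dist_ge0 //.
pose f (i : 'I_D) := x ord0 i - y ord0 i; pose g (i : 'I_D) := y ord0 i - z ord0 i.
have -> : dist x z ^+ 2
    = dist x y ^+ 2 + 2 * (\sum_i f i * g i) + dist y z ^+ 2.
  rewrite !eucl_dist_sqr mulr_sumr -!big_split /=.
  by apply: eq_bigr => i _; rewrite /f /g; ring.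
suff : \sum_i f i * g i <= dist x y * dist y z by lra.
apply: le_trans (ler_norm _) _.
rewrite -ler_sqr ?nnegrE ?mulr_ge0 ?eucl_dist_ge0 // real_normK ?num_real //.
by rewrite exprMn !eucl_dist_sqr; exact: sum_mul_sqr_le.
Qed.

Lemma fmeanE S (i : 'I_D) : S != fset0 ->
  #|` S|%:R * fmean S ord0 i = \sum_(x <- S) x ord0 i.
Proof.
move=> S0; rewrite /fmean mxE summxE mulrA mulfV ?mul1r //.
by rewrite pnatr_eq0 cardfs_eq0.
Qed.

(** Parallel axis identity, proved coordinate by coordinate; the cross terms are evaluated by
    [fmeanE]. *)
Lemma sum_eucl_dist_sqr S c :
  \sum_(x <- S) dist x c ^+ 2
  = mean_cost S + #|` S|%:R * dist (fmean S) c ^+ 2.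
Proof.
have [->|S0] := eqVneq S fset0.
  by rewrite /mean_cost !big_seq_fset0 cardfs0 mul0r addr0.
rewrite /mean_cost eucl_dist_sqr mulr_sumr.
under eq_bigr do rewrite eucl_dist_sqr.
under [in RHS]eq_bigr do rewrite eucl_dist_sqr.
rewrite exchange_big [X in _ = X + _]exchange_big -big_split /=.
apply: eq_bigr => i _.
set m := fmean S ord0 i; set a := c ord0 i.
have -> : \sum_(x <- S) (x ord0 i - a) ^+ 2
  = \sum_(x <- S) ((x ord0 i - m) ^+ 2 + 2 * (m - a) * x ord0 i
      + (a ^+ 2 - m ^+ 2)).
  by apply: eq_bigr => x _; ring.
(* Naming the constant [e] keeps [big_split] from breaking it apart. *)
have [e eE] : exists e, e = a ^+ 2 - m ^+ 2 by eexists.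
rewrite -eE !big_split /= -mulr_sumr -fmeanE // -/m.
rewrite big_const_seq iter_addr_0 count_predT -(mulr_natl e).
by rewrite -/m eE; ring.
Qed.

Lemma mean_cost_ge0 S : 0 <= mean_cost S.
Proof. by apply: sumr_ge0 => x _; exact: sqr_ge0. Qed.

Lemma mean_cost_le S c : mean_cost S <= \sum_(x <- S) dist x c ^+ 2.
Proof. by rewrite sum_eucl_dist_sqr lerDl mulr_ge0 // sqr_ge0. Qed.

End EuclideanDistance.

(** * Sums and averages over finite sets *)

Section FsetSums.
Variables (R : realType) (K : choiceType).

Lemma ler_sum_fsub (A B : {fset K}) (f : K -> R) :
  (A `<=` B)%fset -> (forall x, 0 <= f x) ->
  \sum_(x <- A) f x <= \sum_(x <- B) f x.
Proof.
move=> AB f0; rewrite [leRHS](big_fsetID _ (mem A)) /=.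
have -> : [fset x in B | mem A x]%fset = A.
  apply/fsetP => y; rewrite !inE /=; apply/andP/idP => [[]//|yA]; split => //.
  exact: (fsubsetP AB).
by rewrite lerDl; apply: sumr_ge0 => x _; exact: f0.
Qed.

(** Some value is at most the average; this is the form in which all Markov-type arguments are used
    below. *)
Lemma exists_le_average (A : {fset K}) (f : K -> R) (w : R) :
  A != fset0 -> \sum_(x <- A) f x <= w ->
  exists2 x, x \in A & #|` A|%:R * f x <= w.
Proof.
move=> A0 fw; apply: contrapT => H.
have lt x : x \in A -> w < #|` A|%:R * f x.
  by move=> xA; rewrite ltNge; apply/negP => le; apply: H; exists x.
suff : #|` A|%:R * w < #|` A|%:R * \sum_(x <- A) f x.
  by apply/negP; rewrite -leNgt ler_pM2l // ltr0n cardfs_gt0.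
have -> : #|` A|%:R * w = \sum_(x <- A) w.
  by rewrite big_const_seq iter_addr_0 count_predT mulr_natl.
rewrite mulr_sumr big_seq_cond [ltRHS]big_seq_cond; apply: ltr_sum.
  have [y yA] := fset0Pn _ A0.
  by apply/hasP; exists y; rewrite ?yA.
by move=> x /andP[/lt].
Qed.

End FsetSums.

(** * Partitions of finite sets and their traces on subsets *)

Section Partitions.
Variable K : choiceType.
Implicit Types (S X B : {fset K}) (P : {fset {fset K}}).

(** Blocks disjoint from [S] leave an empty trace, which a partition may not contain. *)
Definition restrict_fpartition P S : {fset {fset K}} :=
  ([fset B `&` S | B in P] `\ fset0)%fset.

Lemma restrict_fpartitionE P S C : reflect
  (exists B, [/\ B \in P, C = (B `&` S)%fset & C != fset0])
  (C \in restrict_fpartition P S).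
Proof.
rewrite in_fsetD1; apply: (iffP andP) => [[C0 /imfsetP[B BP eC]]|[B [BP eC C0]]].
  by exists B.
by split => //; apply/imfsetP; exists B.
Qed.

Lemma restrict_fpartitionP P S : trivIfset P -> (S `<=` fcover P)%fset ->
  fpartition S (restrict_fpartition P S).
Proof.
move=> /trivIfsetP tP SP; split; last by rewrite in_fsetD1 eqxx.
- apply/fsetP => y; apply/bigfcupP/idP => [[C]|yS].
    rewrite andbT => /restrict_fpartitionE[B [_ -> _]].
    by rewrite inE => /andP[].
  have /bigfcupP[B /andP[BP _] yB] := fsubsetP SP _ yS.
  have yBS : y \in (B `&` S)%fset by rewrite inE yB.
  exists (B `&` S)%fset => //; rewrite andbT.
  by apply/restrict_fpartitionE; exists B; split => //; apply/fset0Pn; exists y.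
- apply/trivIfsetP => _ _ /restrict_fpartitionE[B [BP -> _]]
    /restrict_fpartitionE[C [CP -> _]] neq.
  have /tP : B != C by apply: contra neq => /eqP ->.
  move=> /(_ BP CP); rewrite -!fsetI_eq0 => /eqP BC.
  by rewrite fsetIACA BC fset0I.
Qed.

Lemma card_restrict_fpartition P S :
  (#|` restrict_fpartition P S| <= #|` P|)%N.
Proof.
apply: leq_trans (fsubset_leq_card (fsubD1set _ _)) _.
exact: leq_imfset_card.
Qed.

Lemma restrict_fpartition_le P S k : trivIfset P -> (S `<=` fcover P)%fset ->
  (#|` P| <= k)%N -> fpartitions_le S k (restrict_fpartition P S).
Proof.
move=> tP SP Pk; split; first exact: restrict_fpartitionP.
exact: leq_trans (card_restrict_fpartition _ _) Pk.
Qed.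

Lemma fpartitions_le_nonempty S k : (0 < k)%N -> fpartitions_le S k !=set0.
Proof.
(* Restricting the one-block family also handles an empty [S], whose partition has no block. *)
move=> k0; exists (restrict_fpartition [fset S]%fset S).
have cS : fcover [fset S]%fset = S by rewrite /fcover big_seq_fset1.
apply: restrict_fpartition_le; rewrite ?cS ?cardfs1 //.
by apply/trivIfsetP => B C; rewrite !inE => /eqP -> /eqP ->; rewrite eqxx.
Qed.

Lemma fpartition_sub S P B : fpartition S P -> B \in P -> (B `<=` S)%fset.
Proof.
move=> [<- _ _] BP; apply/fsubsetP => y yB.
by apply/bigfcupP; exists B; rewrite ?BP.
Qed.

Lemma fpartition_exists S P y : fpartition S P -> y \in S ->
  exists2 B, B \in P & y \in B.
Proof. by move=> [<- _ _] /bigfcupP[B]; rewrite andbT; exists B.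
Qed.

Lemma fpartition_uniq S P B C y : fpartition S P -> B \in P -> C \in P ->
  y \in B -> y \in C -> B = C.
Proof.
move=> [_ /trivIfsetP tP _] BP CP yB yC; apply/eqP/negPn/negP => /(tP _ _ BP CP).
by move=> /fdisjointP /(_ _ yB); rewrite yC.
Qed.

Lemma sum_fpartition (R : realType) S P (f : K -> R) : fpartition S P ->
  \sum_(y <- S) f y = \sum_(B <- P) \sum_(y <- B) f y.
Proof. by move=> [<- tP _]; rewrite big_trivIfset. Qed.

Lemma card_fpartition S P : fpartition S P ->
  #|` S| = (\sum_(B <- P) #|` B|)%N.
Proof. by move=> [<- /eqP -> _]. Qed.

End Partitions.

(** * Optimal cost: attainment and monotonicity; bounds on diameters *)

Section OptimalCost.
Variables (R : realType) (D : nat).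
Implicit Types (S X : {fset 'rV[R]_D}) (k : nat).

Lemma mean_cost_sub S X : (S `<=` X)%fset -> mean_cost S <= mean_cost X.
Proof.
move=> SX; apply: le_trans (mean_cost_le _ (fmean X)) _.
by apply: ler_sum_fsub => // y; exact: sqr_ge0.
Qed.

(** Blocks are grouped by their trace on [S], since several may share it; a trace costs no more than
    one block of its group. *)
Lemma sum_mean_cost_restrict (P : {fset {fset 'rV[R]_D}}) S :
  \sum_(B <- restrict_fpartition P S) mean_cost B <= \sum_(B <- P) mean_cost B.
Proof.
rewrite [leRHS](partition_big_imfset _ (fun B => (B `&` S)%fset)) /=.
set Q := [fset _ | B in P]%fset.
have ge0 C : 0 <= \sum_(B <- P | (B `&` S)%fset == C) mean_cost B.
  by apply: sumr_ge0 => B _; exact: mean_cost_ge0.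
apply: (@le_trans _ _ (\sum_(C <- restrict_fpartition P S)
    \sum_(B <- P | (B `&` S)%fset == C) mean_cost B)); last first.
  apply: ler_sum_fsub => //; exact: fsubD1set.
rewrite big_seq [leRHS]big_seq; apply: ler_sum => C.
move=> /restrict_fpartitionE[B [BP eC _]].
rewrite big_mkcond (big_fsetD1 B) //= -eC eqxx.
apply: ler_wpDr.
  by apply: sumr_ge0 => B' _; case: ifP => // _; exact: mean_cost_ge0.
by rewrite eC; apply: mean_cost_sub; exact: fsubsetIl.
Qed.

Lemma opt_cost_le S k P : fpartitions_le S k P ->
  opt_cost k S <= \sum_(B <- P) mean_cost B.
Proof.
move=> SP; apply: ge_inf; last by exists P.
exists 0 => _ [Q _ <-]; apply: sumr_ge0 => B _; exact: mean_cost_ge0.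
Qed.

Lemma opt_cost_ge0 S k : (0 < k)%N -> 0 <= opt_cost k S.
Proof.
move=> k0; apply: lb_le_inf.
  by have [P SP] := fpartitions_le_nonempty S k0; eexists; exists P.
by move=> _ [Q _ <-]; apply: sumr_ge0 => B _; exact: mean_cost_ge0.
Qed.

(** All partitions of [S] lie in its finite double power set, so the infimum is a minimum. *)
Lemma opt_cost_attained S k : (0 < k)%N ->
  exists2 P, fpartitions_le S k P & opt_cost k S = \sum_(B <- P) mean_cost B.
Proof.
move=> k0; have [P0 SP0] := fpartitions_le_nonempty S k0.
have bound P : fpartitions_le S k P -> P \in fpowerset (fpowerset S).
  move=> [SP _]; rewrite fpowersetE; apply/fsubsetP => B BP.
  by rewrite fpowersetE; exact: fpartition_sub SP BP.
pose p (Q : fpowerset (fpowerset S)) := `[< fpartitions_le S k (val Q) >].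
pose i0 : fpowerset (fpowerset S) := [` bound _ SP0]%fset.
have p0 : p i0 by apply/asboolP.
have := @Order.TotalTheory.arg_minP _ R _ i0 p
  (fun Q => \sum_(B <- val Q) mean_cost B) p0.
move=> [Q /asboolP pQ minQ]; exists (val Q) => //.
apply/eqP; rewrite eq_le opt_cost_le //=; apply: lb_le_inf.
  by eexists; exists P0.
move=> _ [P SP <-]; have := minQ [` bound _ SP]%fset; apply.
exact/asboolP.
Qed.

Lemma opt_cost_mono S X k : (0 < k)%N -> (S `<=` X)%fset ->
  opt_cost k S <= opt_cost k X.
Proof.
move=> k0 SX; have [P [[cP tP _] Pk] ->] := opt_cost_attained X k0.
apply: le_trans (sum_mean_cost_restrict P S).
by apply/opt_cost_le/restrict_fpartition_le; rewrite ?cP.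
Qed.

Lemma approx_clusters_cost alpha (A : offline_algorithm R D) S k :
  approx_algorithm alpha A -> (0 < k)%N ->
  \sum_(B <- (A S k).1) mean_cost B <= alpha * opt_cost k S.
Proof.
move=> hA k0; have [_] := hA S k k0; apply: le_trans.
by apply: ler_sum => B _; exact: mean_cost_le.
Qed.

Lemma diam_le_ub S l P r : fpartitions_le S l P -> 0 <= r ->
  (forall B y z, B \in P -> y \in B -> z \in B -> eucl_dist y z <= r) ->
  diam_le l S <= r.
Proof.
move=> SP r0 Pr; apply: (@le_trans _ _ (\big[Num.max/0]_(B <- P) diam B)).
  apply: ge_inf; last by exists P.
  exists 0 => _ [Q _ <-]; exact: bigmax_ge_id.
rewrite [leLHS]big_seq; apply: bigmax_le => // B BP.
rewrite /diam [leLHS]big_seq; apply: bigmax_le => // y yB.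
by rewrite [leLHS]big_seq; apply: bigmax_le => // z zB; exact: Pr yB zB.
Qed.

End OptimalCost.

(** * The block containing a given point *)

Section Blocks.
Variable K : choiceType.
Implicit Types (S : {fset K}) (P : {fset {fset K}}).

Definition block P (y : K) : {fset K} :=
  nth fset0 P (find (fun B : {fset K} => y \in B) P).

Lemma blockP S P y : fpartition S P -> y \in S ->
  block P y \in P /\ y \in block P y.
Proof.
move=> SP /(fpartition_exists SP)[B BP yB].
have hasP : has (fun B : {fset K} => y \in B) P by apply/hasP; exists B.
by split; [apply: mem_nth; rewrite -has_find | exact: (nth_find fset0 hasP)].
Qed.

Lemma block_eq S P y B : fpartition S P -> B \in P -> y \in B -> block P y = B.
Proof.
move=> SP BP yB.
have [bP yb] := blockP SP (fsubsetP (fpartition_sub SP BP) _ yB).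
exact: fpartition_uniq SP bP BP yb yB.
Qed.

Lemma sum_block (R : realType) S P (f : K -> {fset K} -> R) : fpartition S P ->
  \sum_(y <- S) f y (block P y) = \sum_(B <- P) \sum_(y <- B) f y B.
Proof.
move=> SP; rewrite (sum_fpartition _ SP).
apply: eq_big_seq => B BP; apply: eq_big_seq => y yB.
by rewrite (block_eq SP BP yB).
Qed.

Lemma card_bigfcup_uniq (s : seq {fset K}) : uniq s ->
  {in s &, forall B C, B != C -> [disjoint B & C]%fset} ->
  #|` (\bigcup_(B <- s) B)%fset| = (\sum_(B <- s) #|` B|)%N.
Proof.
move=> us ds; pose P := [fset B in s]%fset.
have Ps : perm_eq P s by rewrite uniq_perm // => B; rewrite inE.
rewrite -!(perm_big _ Ps) /=.
have tP : trivIfset P.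
  by apply/trivIfsetP => B C; rewrite !inE => Bs Cs; exact: ds.
by rewrite (eqP tP).
Qed.

End Blocks.

(** * Near clusters, and isolation of the new point when their mass is small *)

Section NearClusters.
Variables (R : realType) (D : nat).
Implicit Types (Cs : seq {fset 'rV[R]_D}) (S Q E G : {fset 'rV[R]_D}).
Implicit Types (P : {fset {fset 'rV[R]_D}}) (x y b : 'rV[R]_D).
Local Notation dist := (@eucl_dist R D).
Local Notation center Cs i := (fmean (nth fset0 Cs i)).

Lemma near_clusters_le_size Cs : (near_clusters Cs <= size Cs)%N.
Proof. by apply/bigmax_leqP => i _. Qed.

Lemma clusters_cost_ge0 Cs : 0 <= clusters_cost Cs.
Proof. by apply: sumr_ge0 => B _; exact: mean_cost_ge0. Qed.

(** Cluster 0 passes the test, its only distance being zero, so the maximum is attained at a passing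
    cluster. *)
Lemma near_clusters_pass Cs : (0 < size Cs)%N ->
  (0 < near_clusters Cs)%N /\
  \sum_(j < near_clusters Cs) #|` nth fset0 Cs j|%:R *
     dist (center Cs j) (center Cs (near_clusters Cs).-1) ^+ 2
  <= 100 * clusters_cost Cs.
Proof.
move=> s0; pose p (i : 'I_(size Cs)) :=
  \sum_(j < i.+1) #|` nth fset0 Cs j|%:R * dist (center Cs j) (center Cs i) ^+ 2
    <= 100 * clusters_cost Cs.
have -> : near_clusters Cs = (\max_(i < size Cs | p i) i.+1)%N by [].
have p0 : p (Ordinal s0).
  rewrite /p big_ord_recl big_ord0 /= eucl_distxx expr0n mulr0 addr0.
  by rewrite mulr_ge0 // clusters_cost_ge0.
have card_p : (0 < #|p|)%N by apply/card_gt0P; exists (Ordinal s0).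
have [i pi ->] := eq_bigmax_cond (fun i : 'I_(size Cs) => i.+1) card_p.
by split => //; exact: pi.
Qed.

(** By maximality the cluster of 0-based index [near_clusters Cs] fails; its own term in the test
    vanishes, which leaves a sum over the near clusters. *)
Lemma near_clusters_fail Cs : (near_clusters Cs < size Cs)%N ->
  100 * clusters_cost Cs < \sum_(j < near_clusters Cs) #|` nth fset0 Cs j|%:R *
     dist (center Cs j) (center Cs (near_clusters Cs)) ^+ 2.
Proof.
move=> vs; rewrite ltNge; apply/negP => pass.
suff : (near_clusters Cs < near_clusters Cs)%N by rewrite ltnn.
rewrite {2}/near_clusters; apply: (@leq_bigmax_cond _ _
  (fun i : 'I_(size Cs) => i.+1) (Ordinal vs)) => /=.
by rewrite big_ord_recr /= eucl_distxx expr0n mulr0 addr0.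
Qed.

Definition near_points Cs : {fset 'rV[R]_D} :=
  (\bigcup_(B <- take (near_clusters Cs) Cs) B)%fset.

Lemma near_massE Cs :
  near_mass Cs = (\sum_(B <- take (near_clusters Cs) Cs) #|` B|)%N.
Proof.
rewrite /near_mass (big_nth fset0) size_takel ?near_clusters_le_size // big_mkord.
by apply: eq_bigr => i _; rewrite nth_take.
Qed.

Lemma card_near_points_le Cs : (#|` near_points Cs| <= near_mass Cs)%N.
Proof.
rewrite near_massE /near_points; elim/big_rec2: _ => [|B n U _ Un].
  by rewrite cardfs0.
by rewrite (leq_trans (leq_card_fsetU _ _).1) ?leq_add2l.
Qed.

Section SortedClusters.
Variables (S : {fset 'rV[R]_D}) (P : {fset {fset 'rV[R]_D}}) (x : 'rV[R]_D).
Variable Cs : seq {fset 'rV[R]_D}.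
Hypotheses (SP : fpartition S P) (sCs : sorted_clusters P x Cs).

Let memCs : Cs =i P. Proof. exact: perm_mem sCs.1. Qed.
Let uCs : uniq Cs. Proof. by rewrite (perm_uniq sCs.1) fset_uniq. Qed.

Lemma dist_center_homo i j : (i <= j < size Cs)%N ->
  dist (center Cs i) x <= dist (center Cs j) x.
Proof.
move=> /andP[ij js].
have tr : transitive (fun B B' => dist (fmean B) x <= dist (fmean B') x).
  by move=> ? ? ?; exact: le_trans.
have re : reflexive (fun B B' => dist (fmean B) x <= dist (fmean B') x).
  by move=> ?; exact: lexx.
apply: (sorted_leq_nth tr re fset0 sCs.2) => //; rewrite inE //.
exact: leq_ltn_trans ij js.
Qed.

Lemma card_near_points : #|` near_points Cs| = near_mass Cs.
Proof.
rewrite near_massE; apply: card_bigfcup_uniq; first exact: take_uniq.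
have [_ /trivIfsetP tP _] := SP.
by move=> B C /mem_take + /mem_take; rewrite !memCs; exact: tP.
Qed.

Lemma near_points_sub : (near_points Cs `<=` S)%fset.
Proof.
apply/fsubsetP => y /bigfcupP[B]; rewrite andbT => /mem_take.
by rewrite memCs => BP; exact/fsubsetP/(fpartition_sub SP).
Qed.

Lemma sum_block_Cs (f : 'rV[R]_D -> {fset 'rV[R]_D} -> R) :
  \sum_(y <- S) f y (block P y) = \sum_(B <- Cs) \sum_(y <- B) f y B.
Proof. by rewrite (sum_block _ SP) (perm_big _ sCs.1). Qed.

Lemma sum_dist_block :
  \sum_(y <- S) dist y (fmean (block P y)) ^+ 2 = clusters_cost Cs.
Proof. exact: (sum_block_Cs (fun y B => dist y (fmean B) ^+ 2)). Qed.

Lemma near_pointsP y : y \in S ->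
  (y \in near_points Cs) = (index (block P y) Cs < near_clusters Cs)%N.
Proof.
move=> yS; have [bP yb] := blockP SP yS.
rewrite -in_take ?memCs //.
apply/bigfcupP/idP => [[B]|bt]; last by exists (block P y); rewrite ?bt.
rewrite andbT => Bt yB; rewrite (block_eq SP _ yB) //.
by rewrite -memCs; exact: mem_take Bt.
Qed.

Lemma nth_index_block y : y \in S ->
  nth fset0 Cs (index (block P y) Cs) = block P y /\
  (index (block P y) Cs < size Cs)%N.
Proof.
move=> yS; have [bP _] := blockP SP yS.
by rewrite index_mem memCs; split => //; rewrite nth_index // memCs.
Qed.

(* A cluster center lying beyond the near ones is at distance more than
   5 sqrt (L / M) from the new point; the points that are within
   sqrt (L / M) of their center stay away from it. *)
Lemma isolated_outside (k M : nat) : (#|` P| <= k)%N -> S != fset0 ->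
  (0 < M)%N -> (near_mass Cs <= M)%N ->
  exists2 E : {fset 'rV[R]_D}, (#|` E| < M + M)%N &
    forall Q, (Q `<=` S `\` E)%fset -> Q != fset0 ->
      2 * diam_le k.-1 Q < inf [set dist y x | y in [set` Q]].
Proof.
move=> Pk S0 M0 sM; set L := clusters_cost Cs.
have L0 : 0 <= L by exact: clusters_cost_ge0.
have MR0 : 0 < M%:R :> R by rewrite ltr0n.
(* Points farther than [sqrt (L / M)] from their own center: the squared distances sum to [L] over
   [S], so there are fewer than [M] such points. *)
pose far := [fset y in S | L < M%:R * dist y (fmean (block P y)) ^+ 2]%fset.
have far_lt : (#|` far| < M)%N.
  have [->|far0] := eqVneq far fset0; first by rewrite cardfs0.
  rewrite ltnNge; apply/negP => Mfar.
  have sum_far : \sum_(y <- far) M%:R * dist y (fmean (block P y)) ^+ 2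
      <= M%:R * L.
    rewrite -mulr_sumr ler_pM2l // /L -sum_dist_block.
    apply: ler_sum_fsub => [|y]; last exact: sqr_ge0.
    by apply/fsubsetP => y; rewrite !inE => /andP[].
  have [y yfar le] := exists_le_average far0 sum_far.
  move: yfar; rewrite !inE /= => /andP[yS]; apply/negP; rewrite -leNgt.
  rewrite -(ler_pM2l MR0) (le_trans _ le) // ler_wpM2r ?ler_nat //.
  by rewrite mulr_ge0 ?sqr_ge0.
exists (near_points Cs `|` far)%fset.
  apply: leq_ltn_trans (leq_card_fsetU _ _).1 _.
  rewrite -addnS leq_add // (leq_trans _ sM) //; exact: card_near_points_le.
move=> Q QE Q0.
have inQ y : y \in Q -> [/\ y \in S, (near_clusters Cs <= index (block P y) Cs)%N
    & M%:R * dist y (fmean (block P y)) ^+ 2 <= L].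
  move=> /(fsubsetP QE); rewrite !inE /= => /andP[/norP[yn yf] yS].
  by move: yn yf; rewrite near_pointsP // yS /= -leqNgt -leNgt.
have vs : (near_clusters Cs < size Cs)%N.
  have [y /inQ[yS vy _]] := fset0Pn _ Q0.
  by apply: leq_ltn_trans vy _; case: (nth_index_block yS).
pose rho := dist (center Cs (near_clusters Cs)) x.
pose delta := Num.sqrt (L / M%:R).
have delta0 : 0 <= delta by exact: sqrtr_ge0.
have Mdelta : M%:R * delta ^+ 2 = L.
  by rewrite sqr_sqrtr ?divr_ge0 ?ler0n // mulrC divfK // gt_eqF.
have rho0 : 0 <= rho by exact: eucl_dist_ge0.
(* Near centers are within [rho] of [x], hence within [2 * rho] of the first failing center; the
   failed test then gives [100 * L < 4 * rho ^+ 2 * M]. *)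
have rho_delta : 5 * delta < rho.
  have lt : 100 * L < 4 * rho ^+ 2 * M%:R.
    apply: lt_le_trans (near_clusters_fail vs) _.
    apply: (@le_trans _ _ (4 * rho ^+ 2 * (near_mass Cs)%:R)); last first.
      by rewrite ler_wpM2l ?ler_nat // mulr_ge0 ?sqr_ge0.
    rewrite /near_mass natr_sum mulr_sumr; apply: ler_sum => j _.
    rewrite mulrC ler_wpM2r // [leRHS](_ : _ = (2 * rho) ^+ 2); last by ring.
    rewrite ler_sqr ?nnegrE ?eucl_dist_ge0 ?mulr_ge0 //.
    apply: le_trans (eucl_dist_triangle x _ _) _.
    rewrite (eucl_distC x) mulr_natl mulr2n lerD2r.
    by apply: dist_center_homo; rewrite vs andbT ltnW.
  rewrite -ltr_sqr ?nnegrE ?mulr_ge0 // -(ltr_pM2l MR0).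
  have -> : M%:R * (5 * delta) ^+ 2 = 25 * (M%:R * delta ^+ 2) by ring.
  by rewrite Mdelta; lra.
have Q_close y : y \in Q -> dist y (fmean (block P y)) <= delta.
  move=> /inQ[_ _ le].
  by rewrite -ler_sqr ?nnegrE ?eucl_dist_ge0 // -(ler_pM2l MR0) Mdelta.
have far_from y : y \in Q -> rho - delta <= dist y x.
  move=> yQ; have [yS vy _] := inQ _ yQ; have [nthE ixs] := nth_index_block yS.
  have := eucl_dist_triangle y (fmean (block P y)) x.
  rewrite (eucl_distC _ y).
  have := Q_close _ yQ.
  have : rho <= dist (fmean (block P y)) x.
    by rewrite -nthE; apply: dist_center_homo; rewrite vy.
  by lra.
apply: (@lt_le_trans _ _ (rho - delta)); last first.
  apply: lb_le_inf; last by move=> _ [y yQ <-]; exact: far_from.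
  by have [y yQ] := fset0Pn _ Q0; exists (dist y x), y.
(* Two points within [delta] of one center are within [2 * delta] of each other, and
   [4 * delta < rho - delta]. *)
suff : diam_le k.-1 Q <= 2 * delta by lra.
(* At least one cluster is near, so at most [k - 1] clusters remain. *)
pose P' := [fset B in drop (near_clusters Cs) Cs]%fset.
have P'P B : B \in P' -> B \in P by rewrite inE => /mem_drop; rewrite memCs.
have QP' : fpartitions_le Q k.-1 (restrict_fpartition P' Q).
  have [_ /trivIfsetP tP _] := SP.
  apply: restrict_fpartition_le.
  - by apply/trivIfsetP => B C /P'P BP /P'P CP; exact: tP.
  - apply/fsubsetP => y /inQ[yS vy _]; have [nthE ixs] := nth_index_block yS.
    have [_ yb] := blockP SP yS.
    apply/bigfcupP; exists (block P y) => //; rewrite andbT inE.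
    rewrite -[X in X \in _]nthE -[index _ _](subnKC vy) -nth_drop mem_nth //.
    by rewrite size_drop ltn_sub2r.
  - rewrite card_fseq undup_id ?drop_uniq // size_drop.
    have v0 : (0 < near_clusters Cs)%N.
      by case: (@near_clusters_pass Cs) => //; apply: leq_ltn_trans vs.
    rewrite -subn1 leq_sub // (leq_trans _ Pk) //.
    by rewrite (perm_size sCs.1).
apply: (diam_le_ub QP'); first by rewrite mulr_ge0.
move=> C y z /restrict_fpartitionE[B [/P'P BP -> _]].
rewrite !inE => /andP[yB yQ] /andP[zB zQ].
have := Q_close _ yQ; have := Q_close _ zQ.
rewrite !(block_eq SP BP) //.
have := eucl_dist_triangle (fmean B) y z; rewrite (eucl_distC (fmean B)).
by lra.
Qed.

End SortedClusters.
End NearClusters.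

(** * Consequences of a large near mass *)

Section HeavyClusters.
Variables (R : realType) (D : nat).
Variables (S : {fset 'rV[R]_D}) (P : {fset {fset 'rV[R]_D}}) (x : 'rV[R]_D).
Variable Cs : seq {fset 'rV[R]_D}.
Hypotheses (SP : fpartition S P) (sCs : sorted_clusters P x Cs).
Variables (N : nat) (u w : R).
Hypotheses (N0 : (0 < N)%N) (u0 : 0 <= u) (Nuw : N%:R * u ^+ 2 = w).
Hypothesis Csw : clusters_cost Cs <= w.
Local Notation dist := (@eucl_dist R D).
Local Notation center Cs i := (fmean (nth fset0 Cs i)).

Let NR0 : 0 < N%:R :> R. Proof. by rewrite ltr0n. Qed.

Let le_of_sqr (t c : R) : 0 <= t -> 0 <= c ->
  N%:R * t ^+ 2 <= c ^+ 2 * w -> t <= c * u.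
Proof.
move=> t0 c0 le; rewrite -ler_sqr ?nnegrE ?mulr_ge0 // -(ler_pM2l NR0).
suff -> : N%:R * (c * u) ^+ 2 = c ^+ 2 * w by [].
by rewrite -Nuw; ring.
Qed.

(* The points of [G] carry a total weight of at least [N / 4] close to [x];
   the test defining [near_clusters] lets this weight move to the last near
   center at cost at most [100 * w], so that this center is close to [x]. *)
Lemma near_centers_close (G : {fset 'rV[R]_D}) : (G `<=` S)%fset ->
  (N <= 4 * #|` G|)%N -> (forall y, y \in G -> dist y x <= 4 * u) ->
  forall B, B \in take (near_clusters Cs) Cs -> dist (fmean B) x <= 26 * u.
Proof.
move=> GS NG Gx.
have G0 : G != fset0.
  rewrite -cardfs_gt0 lt0n; apply/eqP => G0; move: NG N0.
  by rewrite G0 muln0 leqn0 => /eqP ->.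
have s0 : (0 < size Cs)%N.
  have [y /(fsubsetP GS) yS] := fset0Pn _ G0.
  by apply: leq_ltn_trans (nth_index_block SP sCs yS).2.
have [v0 pass] := near_clusters_pass s0.
set v := near_clusters Cs in v0 pass *.
have vs : (v <= size Cs)%N := near_clusters_le_size Cs.
set last := center Cs v.-1 in pass.
pose delta (B : {fset 'rV[R]_D}) : R :=
  if (index B Cs < v)%N then dist (fmean B) last else 0.
have delta0 B : 0 <= delta B.
  by rewrite /delta; case: ifP => // _; exact: eucl_dist_ge0.
(* The weights satisfy [(a + b) ^+ 2 <= 11 * a ^+ 2 + 11 / 10 * b ^+ 2] and bring the total to at
   most [11 * w + 110 * w = 121 * w]. Averaging over the at least [N / 4] points of [G] yields
   [22 * u], as [22 ^ 2 = 4 * 121]. *)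
pose f y B := 11 * dist y (fmean B) ^+ 2 + 11 / 10 * delta B ^+ 2.
have uCs : uniq Cs by rewrite (perm_uniq sCs.1) fset_uniq.
have sum_delta : \sum_(B <- Cs) \sum_(y <- B) delta B ^+ 2 <= 100 * w.
  apply: (@le_trans _ _ (100 * clusters_cost Cs)); last by rewrite ler_wpM2l.
  apply: le_trans pass; rewrite (big_ord_widen _ (fun j =>
    #|` nth fset0 Cs j|%:R * dist (center Cs j) last ^+ 2) vs).
  rewrite (big_nth fset0) big_mkord [leRHS]big_mkcond; apply: ler_sum => j _.
  rewrite /delta index_uniq //.
  rewrite big_const_seq iter_addr_0 count_predT -[leLHS]mulr_natl.
  by case: ifP => // _; rewrite expr0n mulr0.
have sumf : \sum_(y <- S) f y (block P y) <= 121 * w.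
  rewrite (sum_block_Cs SP sCs).
  have -> : \sum_(B <- Cs) \sum_(y <- B) f y B = 11 * clusters_cost Cs
      + 11 / 10 * \sum_(B <- Cs) \sum_(y <- B) delta B ^+ 2.
    rewrite /clusters_cost !mulr_sumr -big_split /=; apply: eq_bigr => B _.
    by rewrite /mean_cost !mulr_sumr -big_split.
  by move: Csw sum_delta; lra.
have f0 y B : 0 <= f y B.
  by rewrite addr_ge0 // mulr_ge0 ?sqr_ge0 //; lra.
have sumG := le_trans (ler_sum_fsub GS (fun y => f0 y (block P y))) sumf.
have [y yG fy] := exists_le_average G0 sumG.
have yS := fsubsetP GS _ yG.
have [nthE ixs] := nth_index_block SP sCs yS.
set B := block P y in nthE ixs fy *.
have close : dist y (fmean B) + delta B <= 22 * u.
  apply: le_of_sqr => //; first by rewrite addr_ge0 ?eucl_dist_ge0.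
  have le1 : (dist y (fmean B) + delta B) ^+ 2 <= f y B.
    rewrite /f -subr_ge0.
    have -> : 11 * dist y (fmean B) ^+ 2 + 11 / 10 * delta B ^+ 2
        - (dist y (fmean B) + delta B) ^+ 2
      = (delta B - 10 * dist y (fmean B)) ^+ 2 / 10 by field.
    by rewrite divr_ge0 ?sqr_ge0.
  have le2 : N%:R * f y B <= 4 * (#|` G|%:R * f y B).
    by rewrite mulrA ler_wpM2r // -natrM ler_nat.
  apply: le_trans (ler_wpM2l (ltW NR0) le1) (le_trans le2 _).
  by move: fy; rewrite -[leLHS]/(#|` G|%:R * f y B); move: (_ * f y B) => z; lra.
(* If the block of [y] is near, [last] is reached through its center; otherwise that center comes
   later in the order and [last] is no farther from [x]. Both cases give [22 * u + 4 * u]. *)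
have lastx : dist last x <= 26 * u.
  have yx := Gx _ yG.
  have By := eucl_dist_triangle y (fmean B) x; rewrite eucl_distC in close.
  move: close; rewrite /delta; case: ltnP => [_|vB] close.
    have := eucl_dist_triangle (fmean B) last x; rewrite (eucl_distC last (fmean B)).
    by move: By close yx; lra.
  have : dist last x <= dist (center Cs (index B Cs)) x.
    by apply: (dist_center_homo sCs); rewrite ixs (leq_trans (leq_pred _)).
  by rewrite nthE; move: By close yx; lra.
move=> C Ct; apply: le_trans lastx.
have iv : (index C Cs < v)%N by rewrite -in_take // (mem_take Ct).
rewrite -(nth_index fset0 (mem_take Ct)).
apply: (dist_center_homo sCs); rewrite -ltnS prednK // iv /=.
by rewrite (leq_trans _ vs) // prednK.
Qed.

(* If more than [2 * k * N] points lie in the near clusters, then more than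
   [2 * N] of them belong to the same block of [Q]; they are on average at
   squared distance at most [2 * w / N] from that block's mean. *)
Lemma heavy_near_block (X G : {fset 'rV[R]_D}) (Q : {fset {fset 'rV[R]_D}})
    (k : nat) (b : 'rV[R]_D) :
  fpartition X Q -> (#|` Q| <= k)%N -> \sum_(B <- Q) mean_cost B <= w ->
  (S `<=` X)%fset -> (G `<=` S)%fset -> (N <= 4 * #|` G|)%N ->
  (forall y, y \in G -> dist y x <= 4 * u) -> dist b x <= 2 * u ->
  (2 * k * N < near_mass Cs)%N ->
  exists2 B, B \in Q & (N < #|` B|)%N /\ dist b (fmean B) <= 30 * u.
Proof.
move=> XQ Qk Qw SX GS NG Gx bx heavy; have [cQ tQ _] := XQ.
have nearS := near_points_sub SP sCs.
have nearX := fsubset_trans nearS SX.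
have [B BQ cardB] : exists2 B, B \in Q & (2 * N < #|` (B `&` near_points Cs)%fset|)%N.
  apply: contrapT => H.
  have small B : B \in Q -> (#|` (B `&` near_points Cs)%fset| <= 2 * N)%N.
    by move=> BQ; rewrite leqNgt; apply/negP => lt; apply: H; exists B.
  suff : (near_mass Cs <= 2 * k * N)%N by rewrite leqNgt heavy.
  rewrite -cQ in nearX.
  have [nP nk] := restrict_fpartition_le tQ nearX Qk.
  rewrite -(card_near_points SP sCs) (card_fpartition nP) mulnAC mulnC.
  apply: (@leq_trans (\sum_(C <- restrict_fpartition Q (near_points Cs)) 2 * N)).
    rewrite big_seq [leqRHS]big_seq; apply: leq_sum => C.
    by move=> /restrict_fpartitionE[B [BQ -> _]]; exact: small.
  by rewrite big_const_seq count_predT iter_addn_0 mulnC leq_mul2r nk orbT.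
pose H := (B `&` near_points Cs)%fset.
have HS : (H `<=` S)%fset := fsubset_trans (fsubsetIr _ _) nearS.
have H0 : H != fset0 by rewrite -cardfs_gt0; exact: leq_trans cardB.
pose e z := dist z (fmean (block P z)); pose f z := dist z (fmean B).
(* Some point of [H] is then close both to its cluster center and to the mean of [B], because
   [(e + f) ^+ 2 <= 2 * e ^+ 2 + 2 * f ^+ 2]. *)
have sumH : \sum_(z <- H) (2 * e z ^+ 2 + 2 * f z ^+ 2) <= 4 * w.
  rewrite big_split /= -!mulr_sumr.
  have le1 : \sum_(z <- H) e z ^+ 2 <= w.
    apply: le_trans Csw; rewrite -(sum_dist_block SP sCs).
    by apply: ler_sum_fsub => // z; exact: sqr_ge0.
  have le2 : \sum_(z <- H) f z ^+ 2 <= w.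
    apply: le_trans Qw; apply: (@le_trans _ _ (mean_cost B)).
      by apply: ler_sum_fsub => [|z]; [exact: fsubsetIl | exact: sqr_ge0].
    rewrite (big_fsetD1 B) //= lerDl.
    by apply: sumr_ge0 => C _; exact: mean_cost_ge0.
  by move: le1 le2; lra.
have [z zH le] := exists_le_average H0 sumH.
have [zB zn] : z \in B /\ z \in near_points Cs.
  by move: zH; rewrite inE => /andP[].
have ef : e z + f z <= 2 * u.
  apply: le_of_sqr => //; first by rewrite addr_ge0 ?eucl_dist_ge0.
  have le1 : (e z + f z) ^+ 2 <= 2 * e z ^+ 2 + 2 * f z ^+ 2.
    rewrite -subr_ge0 [leRHS](_ : _ = (e z - f z) ^+ 2) ?sqr_ge0 //; ring.
  have g0 : 0 <= 2 * e z ^+ 2 + 2 * f z ^+ 2.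
    by rewrite addr_ge0 // mulr_ge0 ?sqr_ge0.
  have le2 : N%:R * (2 * e z ^+ 2 + 2 * f z ^+ 2)
      <= #|` H|%:R * (2 * e z ^+ 2 + 2 * f z ^+ 2).
    by rewrite ler_wpM2r // ler_nat (leq_trans _ (ltnW cardB)) // leq_pmull.
  apply: le_trans (ler_wpM2l (ltW NR0) le1) (le_trans le2 _).
  by move: le; move: (_ * _ : R) => t; lra.
exists B => //; split.
  apply: leq_trans (fsubset_leq_card (fsubsetIl B (near_points Cs))).
  by apply: leq_trans cardB; rewrite ltnS leq_pmull.
have zS := fsubsetP HS _ zH.
have cz : dist (fmean (block P z)) x <= 26 * u.
  apply: (near_centers_close GS NG Gx).
  have [bP _] := blockP SP zS.
  rewrite in_take ?(perm_mem sCs.1) //.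
  by rewrite -(near_pointsP SP sCs).
move: ef; rewrite /e /f => ef.
(* The path from [b] through [x], the cluster center of [z] and [z] to the mean of [B] has length at
   most [2 * u + 26 * u + 2 * u]. *)
have t1 := eucl_dist_triangle x b (fmean B).
have t2 := eucl_dist_triangle (fmean (block P z)) x (fmean B).
have t3 := eucl_dist_triangle z (fmean (block P z)) (fmean B).
rewrite (eucl_distC x (fmean (block P z))) in t2.
rewrite (eucl_distC (fmean (block P z)) z) in t3.
by move: ef cz bx t1 t2 t3; lra.
Qed.

End HeavyClusters.

(** * Greedy coloring and conflict-free sets of times *)

Section IndependentSubset.
Local Open Scope nat_scope.

(** Times are colored in increasing order: at most [m] earlier conflicts leave one of the [m.+1]
    colors free. *)
Lemma greedy_coloring (n m : nat) (E : 'I_n -> pred 'I_n) :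
  (forall t : 'I_n, #|[set s : 'I_n | (s < t) && E t s]%SET| <= m) ->
  exists f : 'I_n -> 'I_m.+1, forall s t : 'I_n, s < t -> E t s -> f s != f t.
Proof.
move=> deg.
suff /(_ n (leqnn n))[f fP] : forall j, j <= n -> exists f : 'I_n -> 'I_m.+1,
    forall s t : 'I_n, t < j -> s < t -> E t s -> f s != f t.
  by exists f => s t; exact: fP.
elim=> [|j IHj] jn; first by exists (fun=> ord0).
have [f fP] := IHj (ltnW jn); pose t0 := Ordinal jn.
pose used := f @: [set s : 'I_n | (s < t0) && E t0 s]%SET.
have [c cu] : exists c, c \notin used.
  have : 0 < #|~: used|.
    rewrite cardsCs finset.setCK card_ord subn_gt0 ltnS.
    exact: leq_trans (leq_imset_card _ _) (deg t0).
  by move=> /card_gt0P[c]; rewrite inE => cu; exists c.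
exists (fun t => if t == t0 then c else f t) => s t tj st Est.
have [tt0|tt0] := eqVneq t t0.
  have -> : (s == t0) = false by rewrite -tt0 -val_eqE /= ltn_eqF.
  by apply: contraNneq cu => <-; apply: imset_f; rewrite inE -tt0 Est andbT.
have tj' : t < j.
  move: tj; rewrite ltnS leq_eqVlt => /orP[/eqP tj|//].
  by move: tt0; rewrite -val_eqE /= tj eqxx.
have -> : (s == t0) = false.
  by rewrite -val_eqE /=; apply: ltn_eqF; exact: ltn_trans st tj'.
exact: fP.
Qed.

Lemma independent_subset (n m : nat) (E : 'I_n -> pred 'I_n) (T : {set 'I_n}) :
  (forall t : 'I_n, t \in T -> #|[set s : 'I_n | (s < t) && E t s]%SET| <= m) ->
  exists I : {set 'I_n}, [/\ I \subset T, #|T| <= m.+1 * #|I| &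
    forall s t : 'I_n, s \in I -> t \in I -> s < t -> ~~ E t s].
Proof.
(* Conflicts of times outside [T], whose number is not bounded, are discarded; the largest color
   class within [T] is then taken. *)
move=> deg; pose E' t s := (t \in T) && E t s.
have [t|f fP] := @greedy_coloring n m E'.
  have [tT|tT] := boolP (t \in T).
    apply: leq_trans (deg t tT); apply/subset_leq_card/fintype.subsetP => s.
    by rewrite !inE /E' tT.
  by rewrite /E' (negbTE tT); under eq_finset do rewrite andbF; rewrite cards0.
pose cls c := [set t in T | f t == c]%SET.
have [c hc] : exists c, #|T| <= m.+1 * #|cls c|.
  have [c _ cmax] := @arg_maxnP _ ord0 xpredT (fun c => #|cls c|) isT.
  exists c; have -> : #|T| = \sum_(c' < m.+1) #|cls c'|.
    rewrite -sum1_card (partition_big f xpredT) //=.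
    by apply: eq_bigr => c' _; rewrite sum1dep_card.
  apply: (@leq_trans (\sum_(c' < m.+1) #|cls c|)).
    by apply: leq_sum => c' _; exact: cmax.
  by rewrite sum_nat_const card_ord.
exists (cls c); split => // [|s t].
  by apply/fintype.subsetP => t; rewrite inE => /andP[].
rewrite !inE => /andP[sT /eqP fs] /andP[tT /eqP ft] st.
by apply/negP => Ets; have := fP _ _ st; rewrite /E' tT Ets fs ft eqxx => /(_ isT).
Qed.

End IndependentSubset.

(** * Counting isolated points by (2, k)-sequences *)

Section IsolatedPoints.
Variables (R : realType) (D : nat).
Local Notation dist := (@eucl_dist R D).

(** A time [t] conflicts with an earlier [s] when [x s] lies in [E t]; by injectivity it has at most
    [m] conflicts. In a conflict-free set of times the earlier points avoid [E t], so its points in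
    order of arrival form a (2, k)-sequence. *)
Lemma card_isolated_le (k n m : nat) (x : 'I_n -> 'rV[R]_D)
    (T : {set 'I_n}) (E : 'I_n -> {fset 'rV[R]_D}) :
  injective x ->
  (forall t, t \in T -> (#|` E t| <= m)%N) ->
  (forall t Q, t \in T ->
     (Q `<=` [fset x i | i in 'I_n & (i <= t)%N] `\` E t)%fset -> Q != fset0 ->
     2 * diam_le k.-1 Q < inf [set dist y (x t) | y in [set` Q]]) ->
  (#|T| <= m.+1 * OC k [fset x t | t in 'I_n]%fset)%N.
Proof.
move=> injx leE isoE; set X := [fset x t | t in 'I_n]%fset.
have [t tT|I [IT leT indep]] := @independent_subset n m
    (fun t s => x s \in E t) T.
  apply: leq_trans (leE t tT).
  rewrite cardE -(size_map x); apply: uniq_leq_size.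
    by rewrite map_inj_uniq ?enum_uniq.
  by move=> _ /mapP[s + ->]; rewrite mem_enum inE => /andP[].
apply: leq_trans leT _; rewrite leq_mul2l; apply/orP; right.
pose e := enum I; pose s := [seq x t | t <- e].
have us : uniq s by rewrite map_inj_uniq ?enum_uniq.
have sX : {subset s <= X} by move=> _ /mapP[t _ ->]; exact: in_imfset.
have sizes : size s = #|I| by rewrite size_map -cardE.
have Ilt : (#|I| < #|` X|.+1)%N by rewrite ltnS -sizes uniq_leq_size.
apply: (leq_bigmax_cond (Ordinal Ilt)); apply/asboolP.
exists s; split => // j /andP[j0 js].
have sorted_e : sorted (fun a b : 'I_n => (a < b)%N) e.
  have : sorted ltn [seq val i | i <- enum 'I_n].
    by rewrite val_enum_ord iota_ltn_sorted.
  rewrite sorted_map enumT => srt.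
  apply: sorted_filter; last exact: srt.
  by move=> ? ? ?; exact: ltn_trans.
have je : (j < size e)%N by rewrite -(size_map x).
(* [t0] serves as the default value of [nth]. *)
pose t0 := tnth (in_tuple e) (Ordinal je).
pose t := nth t0 e j.
have -> : s`_j = x t by rewrite (nth_map t0).
have tI : t \in I by rewrite -mem_enum mem_nth.
rewrite /s -map_take.
have earlier y : y \in [seq x i | i <- take j e] ->
    exists i, [/\ i \in I, (i < t)%N & y = x i].
  move=> /mapP[i it ->]; exists i; split => //.
    by rewrite -mem_enum (mem_take it).
  have ij : (index i e < j)%N by rewrite -in_take // (mem_take it).
  rewrite -[i](nth_index t0 (mem_take it)).
  apply: (sorted_ltn_nth (leT := fun a b : 'I_n => (a < b)%N)) => //.
    by move=> ? ? ?; exact: ltn_trans.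
  by rewrite inE (ltn_trans ij).
set Q := [fset y in [seq x i | i <- take j e]]%fset.
have -> : [set` [seq x i | i <- take j e]] = [set` Q].
  by apply/seteqP; split => y /=; rewrite !inE.
apply: isoE; first exact: (fintype.subsetP IT).
  apply/fsubsetP => y; rewrite in_fset => /earlier[i [iI it ->]].
  rewrite !inE indep //=; apply/imfsetP; exists i => //=.
  by rewrite inE /= ltnW.
apply/fset0Pn; exists (x (nth t0 e 0)); rewrite inE /=; apply: map_f.
by rewrite -(nth_take t0 j0); apply: mem_nth; rewrite size_takel // ltnW.
Qed.

End IsolatedPoints.

(** At most [4 * 2 ^ i * c] indices have [2 ^ i <= s t < 2 ^ i.+1], so each dyadic range contributes
    at most [4 * c]; there are [trunc_log 2 n + 1] ranges. *)
Lemma sum_inv_le (R : realType) (n c : nat) (s : 'I_n -> nat) : (0 < n)%N ->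
  (forall t, (0 < s t <= n)%N) ->
  (forall M, (0 < M)%N -> (#|[set t | (s t <= M)%N]%SET| <= (M + M) * c)%N) ->
  \sum_(t < n) (s t)%:R^-1 <= 4 * c%:R * (ln n%:R / ln 2 + 1) :> R.
Proof.
move=> n0 sn hc; set L := trunc_log 2 n.
have logL t : (trunc_log 2 (s t) < L.+1)%N.
  by rewrite ltnS leq_trunc_log //; case/andP: (sn t).
pose g t : 'I_L.+1 := Ordinal (logL t).
have dyadic (i : 'I_L.+1) : \sum_(t < n | g t == i) (s t)%:R^-1 <= 4 * c%:R :> R.
  have pow0 : 0 < 2 ^+ i :> R by rewrite exprn_gt0.
  have sg t : g t == i -> (2 ^ i <= s t < 2 ^ i.+1)%N.
    by move=> /eqP <- /=; apply: trunc_log_bounds => //; case/andP: (sn t).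
  apply: (@le_trans _ _ (\sum_(t < n | g t == i) (2 ^+ i)^-1)).
    apply: ler_sum => t /sg/andP[le _].
    by rewrite lef_pV2 ?posrE // ?ltr0n ?(leq_trans _ le) ?expn_gt0 // -natrX ler_nat.
  rewrite sumr_const -[leLHS]mulr_natr -ler_pdivlMl ?invr_gt0 // invrK.
  have -> : 2 ^+ i * (4 * c%:R) = ((2 ^ i.+1 + 2 ^ i.+1) * c)%:R :> R.
    by rewrite natrM natrD natrX exprS; ring.
  rewrite ler_nat; apply: leq_trans (hc _ _); last by rewrite expn_gt0.
  apply/subset_leq_card/fintype.subsetP => t; rewrite inE => /sg/andP[_].
  exact: ltnW.
rewrite (partition_big g xpredT) //=.
apply: (@le_trans _ _ (\sum_(i < L.+1) 4 * c%:R)).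
  by apply: ler_sum => i _; exact: dyadic.
rewrite sumr_const card_ord -[leLHS]mulr_natr ler_wpM2l ?mulr_ge0 //.
rewrite -natr1 lerD2r ler_pdivlMr ?ln_gt0 ?ltr1n //.
rewrite mulr_natl -lnXn // ler_ln ?posrE ?exprn_gt0 ?ltr0n //.
by rewrite -natrX ler_nat trunc_logP.
Qed.

(** * Points near the mean, late arrivals, and chains of blocks *)

Section Approximation.
Variables (R : realType) (D : nat).
Local Notation dist := (@eucl_dist R D).

(** Points within twice the root mean square distance to the mean, in division-free form. *)
Definition near_mean (B : {fset 'rV[R]_D}) : {fset 'rV[R]_D} :=
  [fset y in B | #|` B|%:R * dist y (fmean B) ^+ 2 <= 4 * mean_cost B]%fset.

(** Markov's inequality: the excluded points exceed four times the average squared distance, so they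
    are at most a quarter of [B]. *)
Lemma card_near_mean (B : {fset 'rV[R]_D}) :
  (3 * #|` B| <= 4 * #|` near_mean B|)%N.
Proof.
pose F := (B `\` near_mean B)%fset.
have cardB : (#|` near_mean B| + #|` F| = #|` B|)%N.
  rewrite -[RHS](cardfsID (near_mean B)); congr (#|` _| + _)%N.
  by apply/esym/fsetIidPr/fsubsetP => y; rewrite !inE => /andP[].
suff : (4 * #|` F| <= #|` B|)%N by lia.
have [->|F0] := eqVneq F fset0; first by rewrite cardfs0.
rewrite leqNgt; apply/negP => lt4.
have sumF : \sum_(y <- F) #|` B|%:R * dist y (fmean B) ^+ 2
    <= #|` B|%:R * mean_cost B.
  rewrite -mulr_sumr ler_wpM2l //; apply: ler_sum_fsub.
    exact: fsubsetDl.
  by move=> y; exact: sqr_ge0.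
have [y yF le] := exists_le_average F0 sumF.
have yfar : 4 * mean_cost B < #|` B|%:R * dist y (fmean B) ^+ 2.
  move: yF; rewrite !inE /= => /andP[+ yB].
  by rewrite yB /= -ltNge.
have F0' : 0 < #|` F|%:R :> R by rewrite ltr0n cardfs_gt0.
have : #|` F|%:R * (4 * mean_cost B) < #|` B|%:R * mean_cost B.
  by apply: lt_le_trans le; rewrite ltr_pM2l.
apply/negP; rewrite -leNgt mulrA; apply: ler_wpM2r; first exact: mean_cost_ge0.
by rewrite -natrM ler_nat mulnC ltnW.
Qed.

(** At the last time of [U], the arrivals in [G] that are not late, all points of [U] are present;
    hence [U] has at most [N / 4] elements, out of at least [3 * N / 4] arrivals in [G]. *)
Lemma card_late (n N : nat) (x : 'I_n -> 'rV[R]_D) (G : {fset 'rV[R]_D}) :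
  injective x -> (G `<=` [fset x t | t in 'I_n])%fset ->
  (3 * N <= 4 * #|` G|)%N ->
  (N <= 2 * #|[set t | (x t \in G) &&
     (N <= 4 * #|` (G `&` [fset x i | i in 'I_n & (i <= t)%N])%fset|)%N]%SET|)%N.
Proof.
move=> injx GX NG; set late := [set t | _]%SET.
pose T := [set t | x t \in G]%SET.
have cardT : (#|` G| <= #|T|)%N.
  rewrite cardE -(size_map x); apply: uniq_leq_size; first exact: fset_uniq.
  move=> y yG; have /imfsetP[t _ ey] := fsubsetP GX _ yG.
  by rewrite ey; apply: map_f; rewrite mem_enum inE -ey.
pose U := (T :\: late)%SET.
have cardU : (#|T| <= #|late| + #|U|)%N.
  by rewrite -(cardsID late T) leq_add2r; apply/subset_leq_card/subsetIr.
suff : (4 * #|U| <= N)%N by lia.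
have [->|/set0Pn[t0 t0U]] := eqVneq U finset.set0; first by rewrite cards0.
have [t tU tmax] := @arg_maxnP _ t0 (mem U) (fun t => val t) t0U.
move: tU; rewrite !inE => /andP[+ tT]; rewrite tT /= -ltnNge => lt.
apply: leq_trans (ltnW lt); rewrite leq_mul2l /=.
rewrite cardE -(size_map x); apply: uniq_leq_size.
  by rewrite map_inj_uniq ?enum_uniq.
move=> _ /mapP[s + ->]; rewrite mem_enum => sU.
have sG : x s \in G by move: sU; rewrite !inE => /andP[].
rewrite inE sG /=; apply/imfsetP; exists s => //=.
by rewrite inE /=; exact: tmax.
Qed.

(* Follow [B], a larger block near [B], and so on: the chain of blocks has
   increasing sizes, hence stops, after at most [k - 1] steps whose lengths
   are all at most [30 * sqrt (w / #|` B|)]. *)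
Lemma cost_of_chains (X C : {fset 'rV[R]_D}) (Q : {fset {fset 'rV[R]_D}})
    (k : nat) (w : R) :
  let u B := Num.sqrt (w / #|` B|%:R) in
  fpartition X Q -> (#|` Q| <= k)%N -> \sum_(B <- Q) mean_cost B <= w ->
  X != fset0 ->
  (forall B, B \in Q ->
     (exists2 c, c \in C & dist c (fmean B) <= 2 * u B) \/
     (exists2 B', B' \in Q &
        (#|` B| < #|` B'|)%N /\ dist (fmean B) (fmean B') <= 30 * u B)) ->
  C != fset0 /\ cost X C <= (1 + 900 * k%:R ^+ 3) * w.
Proof.
move=> u XQ Qk Qw X0 step; have [_ _ Q0] := XQ.
have u0 B : 0 <= u B by exact: sqrtr_ge0.
have w0 : 0 <= w by apply: le_trans Qw; apply: sumr_ge0 => B _; exact: mean_cost_ge0.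
have card0 B : B \in Q -> 0 < #|` B|%:R :> R.
  by move=> BQ; rewrite ltr0n cardfs_gt0; apply: contraNneq Q0 => <-.
pose larger (B : {fset 'rV[R]_D}) := [fset B' in Q | (#|` B| < #|` B'|)%N]%fset.
(* [m] bounds the number of blocks larger than [B]: a move to a larger block lowers it, and every
   move costs at most [30 * u B] since [u] decreases with the size. *)
have chain m B : B \in Q -> (#|` larger B| <= m)%N ->
    exists2 c, c \in C & dist c (fmean B) <= (30 * m%:R + 2) * u B.
  elim: m B => [|m IHm] B BQ Bm.
    have [[c cC le]|[B' B'Q [lt _]]] := step B BQ.
      by exists c; rewrite // mulr0 add0r.
    have : B' \in larger B by rewrite !inE B'Q.
    by move: Bm; rewrite leqn0 cardfs_eq0 => /eqP ->; rewrite inE.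
  have [[c cC le]|[B' B'Q [lt le]]] := step B BQ.
    exists c => //; apply: le_trans le _.
    by rewrite ler_wpM2r // lerDr mulr_ge0.
  have B'm : (#|` larger B'| <= m)%N.
    rewrite -ltnS; apply: leq_trans Bm.
    rewrite (cardfsD1 B' (larger B)) !inE /= B'Q lt ltnS.
    apply/fsubset_leq_card/fsubsetP => C'.
    rewrite !inE /= => /andP[-> lt']; rewrite (ltn_trans lt lt') !andbT.
    by apply: contraTneq lt' => ->; rewrite ltnn.
  have [c cC le'] := IHm B' B'Q B'm; exists c => //.
  have uB' : u B' <= u B.
    rewrite ler_sqrt ?divr_ge0 // ler_wpM2l // lef_pV2 ?posrE ?card0 //.
    by rewrite ler_nat ltnW.
  apply: le_trans (eucl_dist_triangle (fmean B') c (fmean B)) _.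
  rewrite (eucl_distC (fmean B')).
  apply: le_trans (lerD (le_trans le' (ler_wpM2l _ uB')) le) _.
    by rewrite addr_ge0 ?mulr_ge0.
  by rewrite -mulrDl -natr1; apply: ler_wpM2r => //; lra.
(* At most [k - 1] blocks are larger than [B], and [30 * (k - 1) + 2 <= 30 * k]. *)
have close B : B \in Q -> exists2 c, c \in C & dist c (fmean B) <= 30 * k%:R * u B.
  move=> BQ; have k0 : (0 < k)%N.
    by apply: leq_trans Qk; rewrite cardfs_gt0; apply/fset0Pn; exists B.
  have lk : (#|` larger B| <= k.-1)%N.
    rewrite -ltnS prednK //; apply: leq_trans Qk.
    rewrite (cardfsD1 B Q) BQ ltnS; apply/fsubset_leq_card/fsubsetP => C'.
    rewrite !inE /= => /andP[-> lt]; rewrite andbT.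
    by apply: contraTneq lt => ->; rewrite ltnn.
  have [c cC le] := chain _ _ BQ lk; exists c => //.
  apply: le_trans le _; rewrite ler_wpM2r //.
  by rewrite -[in leRHS](prednK k0) -natr1; lra.
have C0 : C != fset0.
  have [y yX] := fset0Pn _ X0; have [B BQ _] := fpartition_exists XQ yX.
  by have [c cC _] := close B BQ; apply/fset0Pn; exists c.
split => //; rewrite /cost (sum_fpartition _ XQ).
apply: (@le_trans _ _ (\sum_(B <- Q) (mean_cost B + 900 * k%:R ^+ 2 * w))).
  rewrite big_seq [leRHS]big_seq; apply: ler_sum => B BQ.
  have [c cC le] := close B BQ.
  apply: (@le_trans _ _ (\sum_(y <- B) dist y c ^+ 2)).
    apply: ler_sum => y _; apply: ge_inf; last by exists c.
    by exists 0 => _ [c' _ <-]; exact: sqr_ge0.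
  rewrite sum_eucl_dist_sqr lerD2l.
  have -> : 900 * k%:R ^+ 2 * w = #|` B|%:R * (30 * k%:R * u B) ^+ 2.
    rewrite exprMn sqr_sqrtr ?divr_ge0 //; field.
    by rewrite gt_eqF // card0.
  rewrite ler_wpM2l // ler_sqr ?nnegrE ?eucl_dist_ge0 ?mulr_ge0 //.
  by rewrite eucl_distC.
rewrite big_split /= [leRHS]mulrDl mul1r; apply: lerD => //.
rewrite big_const_seq iter_addr_0 count_predT -[leLHS]mulr_natl.
have -> : 900 * k%:R ^+ 3 * w = k%:R * (900 * k%:R ^+ 2 * w) by ring.
have M0 : 0 <= 900 * k%:R ^+ 2 * w.
  exact: (mulr_ge0 (mulr_ge0 (ler0n _ _) (sqr_ge0 _)) w0).
have Qk' : #|` Q|%:R <= k%:R :> R by rewrite ler_nat.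
exact: (ler_wpM2r M0 Qk').
Qed.

End Approximation.


(** * Probabilities for finitely many independent events *)

Section Acceptance.
Context d (T : measurableType d) (R : realType) (P : probability T R).
Variables (I : finType) (E : I -> set T) (p : I -> R).
Hypotheses (mE : forall i, measurable (E i)) (PE : forall i, P (E i) = (p i)%:E).
Hypothesis indE : mutually_independent P E.

(** The set [K] of occurring events is carried along for the induction on [J]; with [J] the
    complement of [K], patterns are the atoms of the generated algebra. *)
Let pattern (J K : {set I}) : set T :=
  (\bigcap_(i in [set` J]) ~` E i) `&` \bigcap_(i in [set` K]) E i.

Let measurable_pattern J K : measurable (pattern J K).
Proof.
apply: measurableI; apply: fin_bigcap_measurable => // i _.
exact: measurableC.
Qed.

(** Independence is given for the events, not their complements: each complement is removed by
    writing the pattern as a difference of two patterns with a smaller [J]. *)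
Let probability_pattern (J K : {set I}) : {in J, forall i, i \notin K} ->
  P (pattern J K) = (\prod_(i in J) (1 - p i) * \prod_(i in K) p i)%:E.
Proof.
elim: {J}_.+1 {-2}J (ltnSn #|J|) K => // m IHm J Jm K JK.
have [->|/set0Pn[i iJ]] := eqVneq J finset.set0.
  rewrite /pattern [X in X `&` _](_ : _ = setT); last first.
    by apply/seteqP; split => // w _ i; rewrite /= inE.
  rewrite setTI indE big_set0 mul1r -prodEFin.
  by apply: eq_bigr => i _; rewrite PE.
have iK := JK i iJ.
pose J' := (J :\ i)%SET; pose iK' := (i |: K)%SET.
have J'm : (#|J'| < m)%N.
  by move: Jm; rewrite (cardsD1 i J) iJ ltnS.
have J'K : {in J', forall j, j \notin K}.
  by move=> j; rewrite in_setD1 => /andP[_]; exact: JK.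
have J'iK : {in J', forall j, j \notin iK'}.
  move=> j; rewrite in_setD1 in_setU1 => /andP[ji jJ].
  by rewrite negb_or ji JK.
have splitE : pattern J K = pattern J' K `\` pattern J' iK'.
  apply/seteqP; split => w.
    move=> [wJ wK]; split; first split => //.
      by move=> j /=; rewrite in_setD1 => /andP[_]; exact: wJ.
    by move=> [_ /(_ i)]; rewrite /= in_setU1 eqxx => /(_ isT); exact: wJ.
  move=> [[wJ wK] nw]; split => // j /= jJ Ejw.
  have [ji|ji] := eqVneq j i; last by apply: wJ Ejw; rewrite /= in_setD1 ji.
  apply: nw; split => // l /=; rewrite in_setU1 => /predU1P[->|]; last exact: wK.
  by rewrite -ji.
have sub : pattern J' iK' `<=` pattern J' K.
  move=> w [wJ wK]; split => // j /= jK; apply: wK.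
  by rewrite /= in_setU1 jK orbT.
have -> : P (pattern J K) = (P (pattern J' K) - P (pattern J' iK'))%E.
  rewrite splitE measureD //; first by rewrite setIidr.
  by rewrite (le_lt_trans (probability_le1 _ _)) // ltry.
rewrite IHm // IHm // -EFinB; congr EFin.
by rewrite big_setU1 //= [in RHS](big_setD1 i) //= -/J'; ring.
Qed.

Lemma probability_none (J : {set I}) :
  P (\bigcap_(i in [set` J]) ~` E i) = (\prod_(i in J) (1 - p i))%:E.
Proof.
have := @probability_pattern J finset.set0 (fun i _ => _).
rewrite big_set0 mulr1 /pattern [X in _ `&` X](_ : _ = setT) ?setIT; last first.
  by apply/seteqP; split => // w _ i; rewrite /= inE.
by apply => i; rewrite inE.
Qed.

(** Each factor is at most [1 - Num.min 1 q <= expR (- q)]: the middle term is zero if [1 <= q], and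
    [1 - q] otherwise. *)
Lemma probability_none_le (J : {set I}) (q a : R) :
  (forall i, i \in J -> Num.min 1 q <= p i) -> a <= #|J|%:R * q ->
  (P (\bigcap_(i in [set` J]) ~` E i) <= (expR (- a))%:E)%E.
Proof.
move=> qp aq; rewrite probability_none lee_fin.
have p1 i : p i <= 1 by rewrite -lee_fin -PE; exact: probability_le1.
apply: (@le_trans _ _ (\prod_(i in J) expR (- q))).
  apply: ler_prod => i iJ; rewrite subr_ge0 p1 /=.
  apply: (@le_trans _ _ (1 - Num.min 1 q)); first by rewrite lerD2l lerN2 qp.
  rewrite minEle; case: ifP => _; first by rewrite subrr expR_ge0.
  exact: expR_ge1Dx.
rewrite prodr_const -expRM_natl ler_expR; lra.
Qed.

(** Such a set is a finite union of atoms; this serves for the success event. *)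
Lemma measurable_determined (Z : set T) :
  (forall w w', (forall i, E i w <-> E i w') -> Z w -> Z w') -> measurable Z.
Proof.
move=> detZ; pose atom (J : {set I}) := pattern (~: J)%SET J.
have -> : Z = \bigcup_(J in [set J | atom J `<=` Z]) atom J.
  apply/seteqP; split => [w Zw|w [J sub]]; last exact: sub.
  pose J := [set i | w \in E i]%SET.
  exists J.
    move=> w' [w'nJ w'J]; apply: detZ Zw => i; split => [Ei|Ei'].
      by apply: w'J; rewrite /= inE; exact: mem_set.
    apply: contrapT => nEi; apply: (w'nJ i) Ei'.
    by rewrite /= !inE; apply/negP => /set_mem.
  split => i /=; rewrite !inE //.
  by move=> /negP nEi Ei; apply: nEi; exact: mem_set.
by apply: fin_bigcup_measurable => // J _; exact: measurable_pattern.
Qed.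

End Acceptance.

Lemma probability_bigsetU_le d (T : measurableType d) (R : realType)
    (P : probability T R) (I : Type) (s : seq I) (F : I -> set T) :
  (forall i, measurable (F i)) ->
  (P (\big[setU/set0]_(i <- s) F i) <= \sum_(i <- s) P (F i))%E.
Proof.
move=> mF; elim: s => [|i s IHs]; first by rewrite !big_nil measure0.
rewrite !big_cons; apply: le_trans (measureU2 _ _ _) _ => //.
  exact: bigsetU_measurable.
exact: leeD2l.
Qed.


(** * The algorithm on a fixed stream *)

Section OnlineRun.
Variables (R : realType) (D : nat) (k : nat) (alpha : R).
Variable A : offline_algorithm R D.
Variables (n : nat) (x : 'I_n -> 'rV[R]_D) (Cs : 'I_n -> seq {fset 'rV[R]_D}).
Hypotheses (hk : (2 <= k)%N) (halpha : 1 <= alpha).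
Hypotheses (hA : approx_algorithm alpha A) (hx : injective x).
Let arrived (t : 'I_n) := [fset x i | i in 'I_n & (i <= t)%N]%fset.
Hypothesis hCs :
  forall t, sorted_clusters (A (arrived t) k).1 (x t) (Cs t).
Let X := [fset x t | t in 'I_n]%fset.
Local Notation dist := (@eucl_dist R D).

Let k0 : (0 < k)%N. Proof. exact: ltnW. Qed.

Let clustering t :
  fpartition (arrived t) (A (arrived t) k).1 /\ (#|` (A (arrived t) k).1| <= k)%N.
Proof. exact: (hA (arrived t) k0).1. Qed.

Let arrived_new t : x t \in arrived t.
Proof. by apply/imfsetP; exists t => //=; rewrite inE /=. Qed.

Let arrived_sub t : (arrived t `<=` X)%fset.
Proof.
by apply/fsubsetP => _ /imfsetP[i _ ->]; exact: in_imfset.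
Qed.

Let arrived_neq0 t : arrived t != fset0.
Proof. by apply/fset0Pn; exists (x t). Qed.

Let clusters_cost_le t : clusters_cost (Cs t) <= alpha * opt_cost k X.
Proof.
rewrite /clusters_cost (perm_big _ (hCs t).1) /=.
apply: le_trans (approx_clusters_cost _ hA k0) _.
rewrite ler_pM2l ?(lt_le_trans _ halpha) //; exact: opt_cost_mono.
Qed.

Lemma near_mass_bounds t : (0 < near_mass (Cs t) <= n)%N.
Proof.
have [tP _] := clustering t.
have [BP xB] := blockP tP (arrived_new t).
have [nthE ixs] := nth_index_block tP (hCs t) (arrived_new t).
have s0 : (0 < size (Cs t))%N by exact: leq_ltn_trans ixs.
have [v0 _] := near_clusters_pass s0; apply/andP; split.
  rewrite -(card_near_points tP (hCs t)) cardfs_gt0.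
  have B0P : nth fset0 (Cs t) 0 \in (A (arrived t) k).1.
    by rewrite -(perm_mem (hCs t).1) mem_nth.
  have [y yB0] : exists y, y \in nth fset0 (Cs t) 0.
    by apply/fset0Pn; have [_ _] := tP; apply: contraNneq => <-.
  apply/fset0Pn; exists y; apply/bigfcupP; exists (nth fset0 (Cs t) 0) => //.
  rewrite andbT -(nth_take _ v0) mem_nth // size_takel //.
  exact: near_clusters_le_size.
rewrite -(card_near_points tP (hCs t)).
apply: leq_trans (fsubset_leq_card (near_points_sub tP (hCs t))) _.
apply: leq_trans (fsubset_leq_card (arrived_sub t)) _.
rewrite -[leqRHS](card_ord n) -(size_codom x); apply: uniq_leq_size.
  exact: fset_uniq.
by move=> _ /imfsetP[i _ ->]; exact: codom_f.
Qed.

Lemma card_light_le (M : nat) : (0 < M)%N ->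
  (#|[set t | (near_mass (Cs t) <= M)%N]%SET| <= (M + M) * OC k X)%N.
Proof.
move=> M0.
(* Times with near mass above [M] receive the default [fset0], about which nothing is claimed. *)
have /choice[E EP] : forall t, exists E : {fset 'rV[R]_D},
    (near_mass (Cs t) <= M)%N -> (#|` E| < M + M)%N /\
    forall Q, (Q `<=` arrived t `\` E)%fset -> Q != fset0 ->
      2 * diam_le k.-1 Q < inf [set dist y (x t) | y in [set` Q]].
  move=> t; have [tP Pk] := clustering t.
  have [sM|_] := leqP (near_mass (Cs t)) M; last by exists fset0.
  have [E lt iso] := isolated_outside tP (hCs t) Pk (arrived_neq0 t) M0 sM.
  by exists E.
have MM0 : (0 < M + M)%N by rewrite addn_gt0 M0.
(* At most [2 * M - 1] exceptional points call for [2 * M] colors, so [M + M] is written as a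
   successor. *)
rewrite -(prednK MM0); apply: (card_isolated_le (E := E) hx) => [t|t Q]; rewrite inE.
  by move=> /(EP t)[lt _]; rewrite -ltnS (prednK MM0).
by move=> /(EP t)[_]; apply.
Qed.

Lemma sum_accept_prob_le : (0 < n)%N ->
  \sum_t accept_prob k (Cs t)
    <= 160 * (OC k X)%:R * k%:R * ln k%:R * (ln n%:R / ln 2 + 1) :> R.
Proof.
move=> n0.
have lnk : 0 <= ln k%:R :> R by rewrite ln_ge0 // ler1n.
have ck : 0 <= 20 * k%:R * ln k%:R :> R by rewrite !mulr_ge0.
apply: (@le_trans _ _ (\sum_t 20 * k%:R * ln k%:R * (near_mass (Cs t))%:R^-1)).
  by apply: ler_sum => t _; rewrite /accept_prob ge_min lexx orbT.
rewrite -mulr_sumr; apply: le_trans (ler_wpM2l ck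
  (sum_inv_le R n0 near_mass_bounds card_light_le)) _.
(* The dyadic bound gives [20 * 4 = 80], half of the stated constant. *)
have -> : 160 * (OC k X)%:R * k%:R * ln k%:R * (ln n%:R / ln 2 + 1)
  = 2 * (20 * k%:R * ln k%:R * (4 * (OC k X)%:R * (ln n%:R / ln 2 + 1))) :> R.
  by ring.
rewrite -[leLHS]mul1r; apply: ler_wpM2r; last by lra.
have logn : 0 <= ln n%:R / ln 2 + 1 :> R.
  by rewrite addr_ge0 // divr_ge0 ?ln_ge0 ?ler1n // ln_ge0 // ler1n.
exact: mulr_ge0 ck (mulr_ge0 (mulr_ge0 (ler0n _ _) (ler0n _ _)) logn).
Qed.

(** * Hitting the blocks of an optimal partition *)

Section Blocks.
Variable Q : {fset {fset 'rV[R]_D}}.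
Hypotheses (XQ : fpartition X Q) (Qk : (#|` Q| <= k)%N).
Hypothesis Qopt : opt_cost k X = \sum_(B <- Q) mean_cost B.
Let w := alpha * opt_cost k X.
Let u (B : {fset 'rV[R]_D}) : R := Num.sqrt (w / #|` B|%:R).

(** Times at which the new point is a good center for [B] and enough of [B] is present to apply
    [heavy_near_block]. *)
Definition late (B : {fset 'rV[R]_D}) : {set 'I_n} :=
  [set t | (x t \in near_mean B) &&
    (#|` B| <= 4 * #|` (near_mean B `&` arrived t)%fset|)%N]%SET.

(** Light blocks are likely to be hit; the others lead to a larger block nearby. *)
Definition light (B : {fset 'rV[R]_D}) : bool :=
  [forall t in late B, (near_mass (Cs t) <= 2 * k * #|` B|)%N].

Let w_ge : opt_cost k X <= w.
Proof. by rewrite ler_peMl // opt_cost_ge0. Qed.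

Let w0 : 0 <= w. Proof. exact: le_trans (opt_cost_ge0 _ k0) w_ge. Qed.

Let u0 B : 0 <= u B. Proof. exact: sqrtr_ge0. Qed.

Let block_gt0 B : B \in Q -> (0 < #|` B|)%N.
Proof.
by move=> BQ; rewrite cardfs_gt0; have [_ _] := XQ; apply: contraNneq => <-.
Qed.

Let card_mul_u B : B \in Q -> #|` B|%:R * u B ^+ 2 = w.
Proof.
move=> BQ; rewrite sqr_sqrtr ?divr_ge0 // mulrC divfK //.
by rewrite pnatr_eq0 -lt0n block_gt0.
Qed.

Let near_mean_close B y : B \in Q -> y \in near_mean B -> dist y (fmean B) <= 2 * u B.
Proof.
move=> BQ; rewrite !inE /= => /andP[yB le].
have BR0 : 0 < #|` B|%:R :> R by rewrite ltr0n block_gt0.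
rewrite -ler_sqr ?nnegrE ?eucl_dist_ge0 ?mulr_ge0 // -(ler_pM2l BR0).
apply: le_trans le _.
have -> : #|` B|%:R * (2 * u B) ^+ 2 = 4 * (#|` B|%:R * u B ^+ 2) by ring.
rewrite card_mul_u // ler_pM2l //; apply: le_trans w_ge; rewrite Qopt.
by rewrite (big_fsetD1 B) //= lerDl; apply: sumr_ge0 => C _; exact: mean_cost_ge0.
Qed.

Lemma card_late_ge B : B \in Q -> (#|` B| <= 2 * #|late B|)%N.
Proof.
move=> BQ; apply: card_late => //; last exact: card_near_mean.
apply: fsubset_trans (fpartition_sub XQ BQ).
by apply/fsubsetP => y; rewrite !inE => /andP[].
Qed.

Lemma heavy_block_step B : B \in Q -> ~~ light B ->
  exists2 B', B' \in Q &
    (#|` B| < #|` B'|)%N /\ dist (fmean B) (fmean B') <= 30 * u B.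
Proof.
move=> BQ; rewrite negb_forall_in => /existsP[t /andP[]].
rewrite inE => /andP[xt lt]; rewrite -ltnNge => heavy.
have [tP Pk] := clustering t.
apply: (heavy_near_block tP (hCs t) (block_gt0 BQ) (u0 B) (card_mul_u BQ)
  (clusters_cost_le t) XQ Qk _ (arrived_sub t) (fsubsetIr _ _) lt _ _ heavy).
- by rewrite -Qopt.
(* Both points are within [2 * u B] of the mean of [B]. *)
- move=> y; rewrite in_fsetI => /andP[yB _].
  apply: le_trans (eucl_dist_triangle (fmean B) _ _) _.
  rewrite (eucl_distC (fmean B)).
  have := near_mean_close BQ yB; have := near_mean_close BQ xt; lra.
- by rewrite eucl_distC; exact: near_mean_close.
Qed.

Lemma cost_of_hits (C : {fset 'rV[R]_D}) : X != fset0 ->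
  (forall B, B \in Q -> light B -> exists2 t, t \in late B & x t \in C) ->
  C != fset0 /\ cost X C <= 1358 * alpha * k%:R ^+ 3 * opt_cost k X.
Proof.
move=> X0 hits; have Qw : \sum_(B <- Q) mean_cost B <= w by rewrite -Qopt.
have [|C0 le] := cost_of_chains XQ Qk Qw X0 (C := C).
  move=> B BQ; have [lB|hB] := boolP (light B).
    have [t] := hits B BQ lB; rewrite inE => /andP[xt _] xC.
    by left; exists (x t) => //; exact: near_mean_close.
  by right; exact: heavy_block_step.
split => //; apply: le_trans le _.
have -> : 1358 * alpha * k%:R ^+ 3 * opt_cost k X = 1358 * k%:R ^+ 3 * w.
  by rewrite /w; ring.
(* The factor [alpha] is inside [w], and [1 + 900 * k ^+ 3 <= 1358 * k ^+ 3]. *)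
rewrite ler_wpM2r //.
have : 1 <= k%:R ^+ 3 :> R by rewrite exprn_ege1 // ler1n.
by lra.
Qed.

(** Dividing [20 * k * ln k] by at most [2 * k] times the size of [B] leaves at least [10 * ln k]
    over that size. *)
Lemma light_accept_prob B t : B \in Q -> light B -> t \in late B ->
  Num.min 1 (10 * ln k%:R / #|` B|%:R) <= accept_prob k (Cs t).
Proof.
move=> BQ /forall_inP lB /lB le.
have BR0 : 0 < #|` B|%:R :> R by rewrite ltr0n block_gt0.
have sR0 : 0 < (near_mass (Cs t))%:R :> R.
  by rewrite ltr0n; case/andP: (near_mass_bounds t).
have lnk : 0 <= ln k%:R :> R by rewrite ln_ge0 // ler1n.
rewrite /accept_prob le_min ge_min lexx /= ge_min; apply/orP; right.
rewrite ler_pdivlMr // mulrAC ler_pdivrMr //.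
apply: (@le_trans _ _ (10 * ln k%:R * (2 * k * #|` B|)%:R)).
  by apply: ler_wpM2l; rewrite ?ler_nat // mulr_ge0.
by rewrite !natrM le_eqVlt; apply/orP; left; apply/eqP; ring.
Qed.

End Blocks.
End OnlineRun.

(** * Success probability and expected number of centers *)

Theorem theorem2 (R : realType) (D : nat) (k : nat) (hk : (2 <= k)%N)
    (alpha : R) (halpha : 1 <= alpha)
    (A : offline_algorithm R D) (hA : approx_algorithm alpha A)
    (n : nat) (hn : (0 < n)%N) (x : 'I_n -> 'rV[R]_D) (hx : injective x)
    (X : {fset 'rV[R]_D}) (hX : X = [fset x t | t in 'I_n]%fset)
    (d : measure_display) (T : measurableType d) (P : probability T R)
    (S : T -> {fset 'rV[R]_D}) (hS : online_kmeans A k x P S) :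
  (P [set w | S w != fset0 /\
              (cost X (S w) <= 1358 * alpha * k%:R ^+ 3 * opt_cost k X)%R]
     >= (9 / 10)%:E)%E
  /\
  ('E_P[(fun w => #|` S w|%:R : R)]
     <= (160 * (OC k X)%:R * k%:R * ln k%:R * (ln n%:R / ln 2 + 1))%:E)%E.
Proof.
case: hS => Cs [acc [hCs macc Pacc indep SE]]; subst X.
set X := [fset x t | t in 'I_n]%fset.
have SP w t : (x t \in S w) = (w \in acc t).
  rewrite SE; apply/imfsetP/idP => [[t' + /hx ->]|wt]; first by rewrite inE.
  by exists t; rewrite // inE.
(* As a sum of indicators, the size has the sum of the acceptance probabilities as expectation. *)
have cardS w : #|` S w|%:R = \sum_t \1_(acc t) w :> R.
  have pS : perm_eq (S w) [seq x t | t <- enum [pred t | w \in acc t]].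
    rewrite uniq_perm ?fset_uniq ?map_inj_uniq ?enum_uniq // => y.
    apply/idP/mapP => [|[t + ->]]; last by rewrite mem_enum SP; exact.
    rewrite SE => /imfsetP[t wt ->]; exists t => //.
    by rewrite mem_enum.
  rewrite (perm_size pS) size_map -cardE -sum1_card natr_sum big_mkcond /=.
  by apply: eq_bigr => t _; rewrite indicE inE; case: (w \in acc t).
split; last first.
  have -> : ('E_P[fun w => #|` S w|%:R : R] = (\sum_t accept_prob k (Cs t))%:E)%E.
    rewrite unlock -sumEFin.
    under eq_integral do rewrite cardS -sumEFin.
    rewrite ge0_integral_sum //.
    - apply: eq_bigr => t _.
      by rewrite integral_indic // setIT; exact: Pacc.
    - by move=> t; apply/measurable_EFinP; exact: measurable_indic.
  rewrite lee_fin; exact: (sum_accept_prob_le hk hA hx hCs hn).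
set Z := [set w | _].
have mZ : measurable Z.
  apply: (measurable_determined macc) => w w' ww'.
  suff e : S w = S w' by rewrite /Z /= e.
  rewrite !SE; apply/fsetP => y; apply/imfsetP/imfsetP => -[t + ->];
    by rewrite inE => /ww' wt; exists t; rewrite ?inE.
have [Q [XQ Qk] Qopt] := opt_cost_attained X (ltnW hk).
pose missed B := \bigcap_(t in [set` late x B]) ~` acc t.
have mmissed B : measurable (missed B).
  by apply: fin_bigcap_measurable => // t _; exact: measurableC.
pose lightQ := [seq B <- Q | light k x Cs B].
have X0 : X != fset0.
  by apply/fset0Pn; exists (x (Ordinal hn)); exact: in_imfset.
(* If every light block were hit, [cost_of_hits] would place [w] in [Z]. *)
have missedZ : ~` Z `<=` \big[setU/set0]_(B <- lightQ) missed B.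
  move=> w nZ; apply: contrapT => hit; apply: nZ.
  apply: (cost_of_hits hk halpha hA hCs XQ Qk Qopt X0) => B BQ lB.
  apply: contrapT => miss; apply: hit; rewrite -bigcup_seq.
  exists B; first by rewrite /= mem_filter lB.
  move=> t tB wt; apply: miss; exists t => //.
  by rewrite SP; exact: mem_set.
have k0 : 0 < k%:R :> R by rewrite ltr0n ltnW.
have lnk : 0 <= ln k%:R :> R by rewrite ln_ge0 // ler1n ltnW.
have PmissedB B : B \in lightQ -> (P (missed B) <= (expR (- (5 * ln k%:R)))%:E)%E.
  rewrite mem_filter => /andP[lB BQ].
  have B0 : (0 < #|` B|)%N.
    by rewrite cardfs_gt0; have [_ _] := XQ; apply: contraNneq => <-.
  apply: (probability_none_le macc Pacc indep (q := 10 * ln k%:R / #|` B|%:R)).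
    by move=> t tB; exact: (light_accept_prob hk hA hCs XQ BQ lB tB).
  (* The late times are at least half as many as the points of [B], which turns [10 * ln k] into the
     exponent [5 * ln k]. *)
  rewrite mulrA ler_pdivlMr ?ltr0n //.
  have := card_late_ge hx XQ BQ; rewrite -(ler_nat R) natrM => le.
  have := ler_wpM2l lnk le; lra.
have Pmissed : (P (~` Z) <= (1 / 10)%:E)%E.
  apply: le_trans (le_measure _ _ _ missedZ) _.
  - by rewrite inE; exact: measurableC.
  - by rewrite inE; apply: bigsetU_measurable.
  apply: le_trans (probability_bigsetU_le _ _ mmissed) _.
  apply: (@le_trans _ _ (\sum_(B <- lightQ) (expR (- (5 * ln k%:R)))%:E)).
    by rewrite big_seq [leRHS]big_seq; apply: lee_sum => B; exact: PmissedB.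
  rewrite sumEFin lee_fin big_const_seq iter_addr_0 count_predT -[leLHS]mulr_natl.
  (* At most [k] terms equal to [k ^- 5] sum to at most [k ^- 4 <= 1 / 16 <= 1 / 10]. *)
  have -> : expR (- (5 * ln k%:R)) = (k%:R ^+ 5)^-1 :> R.
    by rewrite expRN expRM_natl lnK.
  rewrite ler_pdivrMr ?exprn_gt0 //.
  have sizeQ : (size lightQ)%:R <= k%:R :> R.
    by rewrite ler_nat (leq_trans _ Qk) // size_filter count_size.
  apply: le_trans sizeQ _.
  have k2 : 2 <= k%:R :> R by rewrite ler_nat.
  have k4 : 16 <= k%:R ^+ 4 :> R.
    have -> : 16 = 2 ^+ 4 :> R by ring.
    by rewrite lerXn2r ?nnegrE // ltW.
  have := ler_wpM2l (ltW k0) k4; rewrite -exprS; lra.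
have PZ : P (~` Z) = (1 - P Z)%E := probability_setC P mZ.
have finZ : P Z \is a fin_num.
  by rewrite ge0_fin_numE // (le_lt_trans (probability_le1 _ mZ)) // ltry.
rewrite PZ -(fineK finZ) -EFinB lee_fin in Pmissed.
by rewrite -(fineK finZ) lee_fin; lra.
Qed.
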